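(* Let $d\in\mathbb N$, $a\in\mathbb R$, $b\in[a,\infty)$, a measure $\mu\colon\mathcal B([a,b]^d)\to[0,\infty]$, a bounded measurable $f\colon[a,b]^d\to\mathbb R$, and $k\in\mathbb N$ be given, let $\sigma\colon\mathbb R\to\mathbb R$ satisfy $\sigma(x)=(\max\{x,0\})^k$ for all $x\in\mathbb R$, let $D_h$, $\mathcal N_h^\theta$, $\mathcal L_h$ (assumed real-valued) be the associated shallow-network objects and let $(\Omega,\mathcal F,\mathbb P)$, $X_n^m$, $Y_n^m$, $M_n^h$, $\mathfrak L_n^h$, $\mathfrak G_n^h$, $\Phi_n^h$, $\Theta_n^h$ ($m,n,h\in\mathbb N_0$) form a generalized stochastic gradient method, all as defined in the context. For every $h\in\mathbb N$ let $\mathbb L^h\colon\mathbb R^{D_h}\to\mathbb R$ satisfy $\mathbb L^h(\theta)=\mathbb E[|\mathcal N_h^\theta(X_0^0)-Y_0^0|^2]$ for all $\theta\in\mathbb R^{D_h}$. Assume $\mathbb P$-a.s. that $\mathbb E[Y_0^0\mid X_0^0]=f(X_0^0)$, assume $\mathbb P(X_0^0\in B)=\mu(B)$ for all $B\in\mathcal B([a,b]^d)$, assume for all $h\in\mathbb N$ that $\Theta_0^{h,i}$, $i\in\{1,\dots,hd+h\}$, are independent, let $q\colon\mathbb R\to[0,\infty)$ be measurable, let $\eta\in(0,\infty)$ satisfy $(-\eta,\eta)\subseteq q^{-1}((0,\infty))$, let $\kappa\in\mathbb R$ satisfy for all $h\in\mathbb N$, $i\in\{1,\dots,hd+h\}$,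 $x\in\mathbb R$ that $\mathbb P(h^\kappa\Theta_0^{h,i}<x)=\int_{-\infty}^xq(y)\,dy$, and assume that for all $h\in\mathbb N$ there exists $\vartheta\in\mathbb R^{D_h}$ such that $$\mathbb L^h(\vartheta)=\inf_{\theta\in\mathbb R^{D_h}}\mathbb L^h(\theta)>\mathbb E[|f(X_0^0)-Y_0^0|^2].$$ Then there exists $\delta\in(0,\infty)$ such that for all $h\in\mathbb N$ $$\mathbb P\Bigl(\liminf_{n\to\infty}\mathbb L^h(\Theta_n^h)=\inf_{\theta\in\mathbb R^{D_h}}\mathbb L^h(\theta)\Bigr)\le\delta^{-1}e^{-\delta h}.$$
   Context: Shallow networks. For $h\in\mathbb N_0$ let $D_h=dh+2h+1$, and for $\theta\in\mathbb R^{D_h}$ let $\mathcal N_h^\theta\colon\mathbb R^d\to\mathbb R$, $$\mathcal N_h^\theta(x)=\theta_{dh+2h+1}+\sum_{i=1}^h\theta_{dh+h+i}\,\sigma\Bigl(\theta_{dh+i}+\sum_{j=1}^d\theta_{(i-1)d+j}x_j\Bigr),$$ and $\mathcal L_h(\theta)=\int_{[a,b]^d}(\mathcal N_h^\theta(x)-f(x))^2\,\mu(dx)$, where $\mathcal L_h\colon\mathbb R^{D_h}\to\mathbb R$ is assumed real-valued for every $h\in\mathbb N_0$. Generalized stochastic gradient method. $(\Omega,\mathcal F,\mathbb P)$ is a probability space; for $m,n\in\mathbb N_0$, $X_n^m\colon\Omega\to[a,b]^d$ and $Y_n^m\colon\Omega\to\mathbb R$ are random variables. For every $h,n\in\mathbb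 N_0$: $M_n^h\in\mathbb N$; $\mathfrak L_n^h\colon\mathbb R^{D_h}\times\Omega\to\mathbb R$ is $\mathfrak L_n^h(\theta)=\frac1{M_n^h}\sum_{m=1}^{M_n^h}|\mathcal N_h^\theta(X_n^m)-Y_n^m|^2$; $\mathfrak G_n^h=(\mathfrak G_n^{h,1},\dots,\mathfrak G_n^{h,D_h})\colon\mathbb R^{D_h}\times\Omega\to\mathbb R^{D_h}$ is a function such that for all $i\in\{1,\dots,h\}$, $j\in\{(i-1)d+1,\dots,(i-1)d+d\}\cup\{hd+i\}$, $\theta\in\mathbb R^{D_h}$ and all $\omega\in\Omega$ for which $\mathbb R^{d+1}\ni(\psi_1,\dots,\psi_{d+1})\mapsto\mathfrak L_n^h(\theta_1,\dots,\theta_{(i-1)d},\psi_1,\dots,\psi_d,\theta_{id+1},\dots,\theta_{dh+i-1},\psi_{d+1},\theta_{dh+i+1},\dots,\theta_{D_h},\omega)$ is differentiable at $(\theta_{(i-1)d+1},\dots,\theta_{id},\theta_{hd+i})$ one has $\mathfrak G_n^{h,j}(\theta,\omega)=(\frac{\partial}{\partial\theta_j}\mathfrak L_n^h)(\theta,\omega)$; $\Theta_n^h=(\Theta_n^{h,1},\dots,\Theta_n^{h,D_h})\colon\Omega\to\mathbb R^{D_h}$ is a random variable; $\Phi_n^h=(\Phi_n^{h,1},\dots,\Phi_n^{h,D_h})\colon(\mathbb R^{D_h})^{n+1}\to\mathbb R^{D_h}$ is a function such that for all $g=((g_{i,j})_{j\in\{1,\dots,D_h\}})_{i\in\{0,\dots,n\}}\in(\mathbb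 R^{D_h})^{n+1}$ and $j\in\{1,\dots,D_h\}$ with $\sum_{i=0}^n|g_{i,j}|=0$ one has $\Phi_n^{h,j}(g)=0$; and $\Theta_{n+1}^h=\Theta_n^h-\Phi_n^h(\mathfrak G_0^h(\Theta_0^h),\mathfrak G_1^h(\Theta_1^h),\dots,\mathfrak G_n^h(\Theta_n^h))$, where $\mathfrak G_n^h(\Theta_n^h)$ means $\omega\mapsto\mathfrak G_n^h(\Theta_n^h(\omega),\omega)$. *)

(* Defs.v *)
From HB Require Import structures.
From mathcomp Require Import all_boot all_order all_algebra.
From mathcomp Require Import all_classical all_reals all_analysis.

Set Implicit Arguments.
Unset Strict Implicit.
Unset Printing Implicit Defensive.

Import Order.TTheory GRing.Theory Num.Theory.
Import numFieldNormedType.Exports.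

Local Open Scope classical_set_scope.
Local Open Scope ring_scope.

(* R^n with its Borel sigma-algebra; convertible to 'rV[R]_n. *)
Notation borel_rV R n := (g_sigma_algebraType (@open 'rV[R]_n)).

Definition cube (R : realType) (a b : R) (d : nat) : set 'rV[R]_d :=
  [set x | forall j, a <= x 0 j <= b].
Arguments cube {R} a b d.

Section probability_notions.
Context {d} {T : measurableType d} {R : realType}.
Variable P : probability T R.

Definition mutually_independent (I : finType) (X : I -> T -> R) : Prop :=
  forall (J : {set I}) (A : I -> set R), (forall i, measurable (A i)) ->
    (P (\bigcap_(i in [set` J]) (X i @^-1` A i)) =
     \prod_(i in J) P (X i @^-1` A i))%E.

Definition sigma_of d' (T' : measurableType d') (X : T -> T') : set (set T) :=
  preimage_set_system [set: T] X measurable.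

(* Z is a version of E[Y | X]. *)
Definition is_cond_expectation d' (T' : measurableType d')
    (Y : T -> R) (X : T -> T') (Z : T -> R) : Prop :=
  [/\ P.-integrable setT (EFin \o Y),
      measurable_fun setT (Z : g_sigma_algebraType (sigma_of X) -> R),
      P.-integrable setT (EFin \o Z) &
      forall A, sigma_of X A ->
        (\int[P]_(w in A) (Z w)%:E = \int[P]_(w in A) (Y w)%:E)%E].

End probability_notions.

Section shallow_networks.
Context {R : realType}.

Definition dimD (d h : nat) : nat := (d * h + 2 * h).+1.

(* Parameters are numbered from 0: [param theta k] is $\theta_{k+1}$.  [inord] is
   only ever used below for k < dimD d h. *)
Definition param d h (theta : 'rV[R]_(dimD d h)) (k : nat) : R :=
  theta 0 (inord k).

Definition shallow_net (sigma : R -> R) d h (theta : 'rV[R]_(dimD d h))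
    (x : 'rV[R]_d) : R :=
  param theta (d * h + 2 * h) +
  \sum_(i < h) param theta (d * h + h + i) *
    sigma (param theta (d * h + i) +
           \sum_(j < d) param theta (i * d + j) * x 0 j).

Definition true_loss (sigma : R -> R) (a b : R) d
    (mu : {measure set (borel_rV R d) -> \bar R}) (f : 'rV[R]_d -> R)
    h (theta : 'rV[R]_(dimD d h)) : \bar R :=
  (\int[mu]_(x in cube a b d)
     ((shallow_net sigma theta x - f x) ^+ 2)%:E)%E.

(* Average over the samples m = 1, ..., M of a batch. *)
Definition batch_loss (sigma : R -> R) d (M : nat) (x : nat -> 'rV[R]_d)
    (y : nat -> R) h (theta : 'rV[R]_(dimD d h)) : R :=
  M%:R^-1 * \sum_(1 <= m < M.+1) `|shallow_net sigma theta (x m) - y m| ^+ 2.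

(* Positions of the d input weights and of the bias of hidden neuron i. *)
Definition neuron_index d h (i : 'I_h) (j : nat) : bool :=
  (i * d <= j < i * d + d)%N || (j == d * h + i)%N.

Definition neuron_params d h (theta : 'rV[R]_(dimD d h)) (i : 'I_h) :
    'rV[R]_d.+1 :=
  \row_(l < d.+1)
    if (l < d)%N then param theta (i * d + l) else param theta (d * h + i).

(* theta with the parameters of neuron i replaced by psi. *)
Definition set_neuron d h (theta : 'rV[R]_(dimD d h)) (i : 'I_h)
    (psi : 'rV[R]_d.+1) : 'rV[R]_(dimD d h) :=
  \row_(j < dimD d h)
    if (i * d <= j < i * d + d)%N then psi 0 (inord (j - i * d))
    else if (j == d * h + i :> nat)%N then psi 0 ord_max
    else theta 0 j.

Definition partial_derivative n (F : 'rV[R]_n -> R) (j : 'I_n)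
    (theta : 'rV[R]_n) : R :=
  'D_(delta_mx 0 j) (F : 'rV[R]_n -> R^o) theta.

(* G is a generalized gradient of F: it need only agree with the gradient of F
   in the parameters of those hidden neurons in which F is differentiable. *)
Definition generalized_gradient d h (F : 'rV[R]_(dimD d h) -> R)
    (G : 'rV[R]_(dimD d h) -> 'rV[R]_(dimD d h)) : Prop :=
  forall (i : 'I_h) (j : 'I_(dimD d h)) (theta : 'rV[R]_(dimD d h)),
    neuron_index d i j ->
    differentiable (fun psi : 'rV[R]_d.+1 => F (set_neuron theta i psi) : R^o)
      (neuron_params theta i) ->
    G theta 0 j = partial_derivative F j theta.

(* The rows of g are the n+1 gradients seen so far. *)
Definition preserves_zero_coordinates n D
    (Phi : 'M[R]_(n.+1, D) -> 'rV[R]_D) : Prop :=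
  forall (g : 'M[R]_(n.+1, D)) (j : 'I_D),
    \sum_(i < n.+1) `|g i j| = 0 -> Phi g 0 j = 0.

End shallow_networks.

(* Main.v *)
Require Import Defs.
From HB Require Import structures.
From mathcomp Require Import all_boot all_order all_algebra.
From mathcomp Require Import all_classical all_reals all_analysis.
From mathcomp Require Import measurable_realfun.
From mathcomp Require Import zify ring lra.

Set Implicit Arguments.
Unset Strict Implicit.
Unset Printing Implicit Defensive.

Import Order.TTheory GRing.Theory Num.Theory.
Import numFieldNormedType.Exports.

Local Open Scope classical_set_scope.
Local Open Scope ring_scope.

(** A neuron whose preactivation is negative on the whole cube has zero
    generalized gradient, so its parameters never move and the network behaves
    for all times like one with a hidden neuron less.  The law of the initial
    parameters, up to the scaling [h ^ kappa], does not depend on [h]: each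
    neuron is dead with the same probability [p > 0], independently of the
    others, so all are alive with probability [(1 - p) ^ h].

    It remains to see that [inf L_(h+1) < inf L_h].  Otherwise no neuron can be
    added with profit to a minimizer [N] of [L_h], so that the residual
    [N(X) - Y] is orthogonal to all functions [max (s + v . X) 0 ^ k].  Bounded
    pointwise limits then give orthogonality, successively, to the same
    functions with smaller exponents (differentiate in [s]), to the indicators
    of halfspaces, to the exponentials [exp (s + v . X)], to
    [exp (- sum of such exponentials)] (power series), to the indicators of
    boxes, and to the indicators of all events [X \in B].  Hence [N(X) = f(X)]
    almost surely, which contradicts [inf L_h > E |f(X) - Y|^2]. *)

(** * Shallow networks and dead neurons *)

Lemma near_cst_differentiable {R : realType} {V W : normedModType R}
    (f : V -> W) (x : V) :
  (\forall y \near x, f y = f x) -> differentiable f x.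
Proof.
move=> fx; have df0 : f \o shift x = cst (f x) + (\0 : {linear V -> W}) +o_ 0 id.
  apply/eqaddoP => _/posnumP[e].
  have := fx; rewrite (near_shift 0 x) subr0 => fx0.
  near=> y => /=; rewrite /= !fctE /= addr0.
  have -> : f (y + x) = f x by near: y.
  by rewrite subrr normr0 mulr_ge0.
have c0 : continuous (\0 : {linear V -> W}) by exact: cst_continuous.
by apply/diff_locallyP; rewrite (diff_unique c0 df0).
Unshelve. all: by end_near. Qed.

Lemma affine_coord_continuous {R : realType} {n m : nat} (l : 'I_n)
    (idx : 'I_m -> 'I_n) (x : 'I_m -> R) :
  continuous (fun v : 'rV[R]_n => v 0 l + \sum_(j < m) v 0 (idx j) * x j).
Proof.
move=> v; apply: (@cvgD _ R _ (nbhs v)); first exact: coord_continuous.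
apply: (cvg_big (@add_continuous R)) => j _.
by apply: (@cvgM _ _ (nbhs v)); [exact: coord_continuous|exact: cvg_cst].
Qed.

Section neurons.
Context {R : realType} {d : nat}.
Implicit Types (sigma : R -> R) (x : 'rV[R]_d).

Definition preactivation h (theta : 'rV[R]_(dimD d h)) (i : nat) x : R :=
  param theta (d * h + i) + \sum_(j < d) param theta (i * d + j) * x 0 j.

(** Inverse of the layout read by [shallow_net]: inner weights row by row, then biases, outer
    weights and the offset [c]. The parts are functions on [nat], so that a neuron can be skipped by
    [bump] or appended by a comparison of indices. *)
Definition network h (c : R) (v bias : nat -> R) (w : nat -> nat -> R) :
    'rV[R]_(dimD d h) :=
  \row_(j < dimD d h)
    if (j < d * h)%N then w (j %/ d)%N (j %% d)%N
    else if (j < d * h + h)%N then bias (j - d * h)%N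
    else if (j < d * h + 2 * h)%N then v (j - (d * h + h))%N
    else c.

Lemma shallow_netE sigma h (theta : 'rV[R]_(dimD d h)) x :
  shallow_net sigma theta x = param theta (d * h + 2 * h) +
    \sum_(i < h) param theta (d * h + h + i) * sigma (preactivation theta i x).
Proof. by []. Qed.

Lemma weight_index_lt h i j : (i < h)%N -> (j < d)%N -> (i * d + j < d * h)%N.
Proof. by move=> ih jd; nia. Qed.

Section network.
Variables (h : nat) (c : R) (v bias : nat -> R) (w : nat -> nat -> R).
Local Notation N := (network h c v bias w).

Lemma network_weight i j : (i < h)%N -> (j < d)%N -> param N (i * d + j) = w i j.
Proof.
move=> ih jd; have ijdh := weight_index_lt ih jd.
rewrite /param mxE inordK; last by rewrite /dimD; lia.
by rewrite ijdh divnMDl ?(leq_trans _ jd)// divn_small// addn0 modnMDl modn_small.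
Qed.

Lemma network_bias i : (i < h)%N -> param N (d * h + i) = bias i.
Proof.
move=> ih; rewrite /param mxE inordK; last by rewrite /dimD; lia.
by rewrite ltnNge leq_addr/= ltn_add2l ih addKn.
Qed.

Lemma network_outer i : (i < h)%N -> param N (d * h + h + i) = v i.
Proof.
move=> ih; rewrite /param mxE inordK; last by rewrite /dimD; lia.
rewrite ltnNge -addnA leq_addr/= addnA ltnNge leq_addr/=.
by rewrite (_ : (_ < _)%N = true) ?addKn//; lia.
Qed.

Lemma network_offset : param N (d * h + 2 * h) = c.
Proof.
rewrite /param mxE inordK; last by rewrite /dimD; lia.
by rewrite !ifF//; lia.
Qed.

Lemma shallow_net_network sigma x :
  shallow_net sigma N x =
  c + \sum_(i < h) v i * sigma (bias i + \sum_(j < d) w i j * x 0 j).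
Proof.
rewrite /shallow_net network_offset; congr +%R; apply: eq_bigr => i _.
rewrite network_outer// network_bias//; congr (_ * sigma (_ + _)).
by apply: eq_bigr => j _; rewrite network_weight.
Qed.

End network.

(** Renumbering by [bump i] skips neuron [i]. The smaller network is chosen before [x], so a single
    [theta'] serves the whole region where the neuron is dead. *)
Lemma shallow_net_remove_neuron sigma h (theta : 'rV[R]_(dimD d h.+1))
    (i : 'I_h.+1) : exists theta' : 'rV[R]_(dimD d h), forall x,
  sigma (preactivation theta i x) = 0 ->
  shallow_net sigma theta x = shallow_net sigma theta' x.
Proof.
exists (network h (param theta (d * h.+1 + 2 * h.+1))
  (fun l => param theta (d * h.+1 + h.+1 + bump i l))
  (fun l => param theta (d * h.+1 + bump i l))
  (fun l j => param theta (bump i l * d + j))) => x dead.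
rewrite shallow_net_network shallow_netE; congr +%R.
by rewrite (bigD1_ord i)//= dead mulr0 add0r.
Qed.

Lemma shallow_net_add_neuron sigma h (theta : 'rV[R]_(dimD d h))
    (v b : R) (w : 'I_d -> R) : exists theta' : 'rV[R]_(dimD d h.+1), forall x,
  shallow_net sigma theta' x =
  shallow_net sigma theta x + v * sigma (b + \sum_(j < d) w j * x 0 j).
Proof.
(* The new neuron gets the last index [h]; the default weight 0 for [j] outside ['I_d] is never
   read. *)
exists (network h.+1 (param theta (d * h + 2 * h))
  (fun l => if (l < h)%N then param theta (d * h + h + l) else v)
  (fun l => if (l < h)%N then param theta (d * h + l) else b)
  (fun l j => if (l < h)%N then param theta (l * d + j)
              else if insub j is Some j' then w j' else 0)) => x.
rewrite shallow_net_network shallow_netE -addrA; congr +%R.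
rewrite big_ord_recr/= ltnn; congr (_ + _ * sigma (_ + _)).
  by apply: eq_bigr => i _; rewrite ltn_ord.
by apply: eq_bigr => j _; rewrite valK.
Qed.

(** Only the inner weights and the bias of neuron [i] may differ, and they enter the output through
    a summand that vanishes on both sides. *)
Lemma shallow_net_eq_off_neuron sigma h (theta theta' : 'rV[R]_(dimD d h))
    (i : 'I_h) x :
  (forall j : 'I_(dimD d h), ~~ neuron_index d i j -> theta 0 j = theta' 0 j) ->
  sigma (preactivation theta i x) = 0 -> sigma (preactivation theta' i x) = 0 ->
  shallow_net sigma theta x = shallow_net sigma theta' x.
Proof.
move=> eq_off dead dead'.
have eq_param m : (m < dimD d h)%N -> ~~ ((i * d <= m < i * d + d)%N) ->
    m != (d * h + i)%N -> param theta m = param theta' m.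
  move=> mD m_weight m_bias; apply: eq_off.
  by rewrite /neuron_index inordK// negb_or m_weight m_bias.
have idh : (i * d + d <= d * h)%N by have := ltn_ord i; nia.
rewrite !shallow_netE; congr +%R.
  by apply: eq_param; rewrite /dimD; have := ltn_ord i; lia.
apply: eq_bigr => l _; have [->|l_neq_i] := eqVneq l i.
  by rewrite dead dead' !mulr0.
have {l_neq_i} l_neq_i : l != i :> nat by [].
have := ltn_ord i; have := ltn_ord l => lh ih.
congr (_ * sigma (_ + _)).
- by apply: eq_param; rewrite /dimD; lia.
- by apply: eq_param; rewrite /dimD; lia.
- apply: eq_bigr => j _; have jd := ltn_ord j; congr (_ * _).
  by apply: eq_param; rewrite /dimD; nia.
Qed.

Lemma preactivation_set_neuron h (theta : 'rV[R]_(dimD d h)) (i : 'I_h) psi x :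
  preactivation (set_neuron theta i psi) i x =
  psi 0 ord_max + \sum_(j < d) psi 0 (widen_ord (leqnSn d) j) * x 0 j.
Proof.
have ih := ltn_ord i.
have idh : (i * d + d <= d * h)%N by nia.
rewrite /preactivation /param mxE inordK; last by rewrite /dimD; lia.
rewrite ifF ?eqxx; last by lia.
congr +%R; apply: eq_bigr => j _; have jd := ltn_ord j; congr (_ * _).
rewrite mxE inordK; last by rewrite /dimD; lia.
rewrite ifT; last by lia.
by congr (psi 0 _); apply: val_inj; rewrite /= addKn inordK// ltnS ltnW.
Qed.

Lemma set_neuronK h (theta : 'rV[R]_(dimD d h)) (i : 'I_h) :
  set_neuron theta i (neuron_params theta i) = theta.
Proof.
apply/rowP => j; rewrite !mxE; case: ifPn => [/andP[ij ji]|_].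
  rewrite inordK; last by lia.
  rewrite ifT; last by lia.
  by rewrite /param subnKC// inord_val.
by case: eqP => // <-; rewrite /= ltnn /param inord_val.
Qed.

Lemma set_neuron_off h (theta : 'rV[R]_(dimD d h)) (i : 'I_h) psi
    (j : 'I_(dimD d h)) :
  ~~ neuron_index d i j -> set_neuron theta i psi 0 j = theta 0 j.
Proof.
by rewrite mxE /neuron_index negb_or => /andP[/negbTE-> /negbTE->].
Qed.

(* A neuron that is strictly dead on the batch stays dead under small changes
   of its parameters, so the batch loss is locally constant in them. *)
Lemma gradient_dead_neuron sigma (sigma0 : forall t, t <= 0 -> sigma t = 0)
    M (xs : nat -> 'rV[R]_d) (ys : nat -> R) h
    (theta : 'rV[R]_(dimD d h)) (i : 'I_h) (j : 'I_(dimD d h)) G :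
  generalized_gradient (batch_loss sigma M xs ys (h := h)) G ->
  (forall m, preactivation theta i (xs m) < 0) ->
  neuron_index d i j -> G theta 0 j = 0.
Proof.
move=> gradG dead ij; set F := batch_loss _ _ _ _ (h := h) in gradG.
(* Negativity is asked on the finitely many samples indexed by ['I_M.+1], which include the batch 1,
   ..., [M]; this makes it an open condition on the parameters. *)
have locF (theta' : 'rV[R]_(dimD d h)) :
    (forall l : 'I_(dimD d h), ~~ neuron_index d i l ->
       theta' 0 l = theta 0 l) ->
    (forall m : 'I_M.+1, preactivation theta' i (xs m) < 0) ->
    F theta' = F theta.
  move=> off dead'; rewrite /F /batch_loss; congr (_ * _).
  apply: eq_big_nat => m mM; congr (`|_ - _| ^+ 2).
  apply: (@shallow_net_eq_off_neuron _ _ _ _ i) => //; apply: sigma0.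
    have mM' : (m < M.+1)%N by lia.
    exact/ltW/(dead' (Ordinal mM')).
  exact/ltW.
have near_dead (T : topologicalType) (g : T -> nat -> R) (t0 : T) :
    (forall m, {for t0, continuous (g^~ m)}) -> (forall m, g t0 m < 0) ->
    \forall t \near t0, forall m : 'I_M.+1, g t m < 0.
  by move=> cg g0; apply: filter_forall => m; apply: (cvgr_lt _ (cg m)); exact: g0.
have -> : G theta 0 j = partial_derivative F j theta.
  apply: (gradG i) => //; apply: near_cst_differentiable.
  rewrite /= set_neuronK; near=> psi; apply: locF.
    by move=> l; exact: set_neuron_off.
  near: psi; apply: (near_dead _
    (fun psi m => preactivation (set_neuron theta i psi) i (xs m))).
    move=> m; rewrite (funext (preactivation_set_neuron theta i ^~ (xs m))).
    exact: affine_coord_continuous.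
  by rewrite set_neuronK.
(* The partial derivative is that of the full loss, but along a line that moves only a parameter of
   neuron [i]; so [locF] applies again and the difference quotients vanish near 0. *)
rewrite /partial_derivative /derive; apply: cvg_lim => //.
apply: cvg_near_cst; near=> t.
suff Ft : F (t *: delta_mx 0 j + theta) = F theta.
  rewrite -[LHS]/(t^-1 *: ((F (t *: delta_mx 0 j + theta) : R^o) - F theta)).
  by rewrite Ft subrr scaler0.
apply: locF.
  move=> l lij; rewrite !mxE eqxx/= [l == j]negbTE ?mulr0 ?add0r//.
  by apply: contraNneq lij => ->.
near: t; apply: nbhs_dnbhs.
apply: (near_dead R (fun t m => preactivation (t *: delta_mx 0 j + theta) i (xs m))).
  move=> m; apply: (@continuous_comp _ _ _ (fun t : R => t *: delta_mx 0 j + theta)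
    (fun th : 'rV[R]_(dimD d h) => preactivation th i (xs m))); last first.
    exact: (@affine_coord_continuous _ _ _ _ (fun l => inord (i * d + l))).
  by apply: cvgD; [apply: cvgZr_tmp; exact: cvg_id|exact: cvg_cst].
by move=> m; rewrite /= scale0r add0r.
Unshelve. all: by end_near. Qed.

End neurons.

(** * Probability of a dead neuron at initialization *)

Section dead_at_initialization.
Context {R : realType} {disp : measure_display} {Omega : measurableType disp}.
Variable P : probability Omega R.

(* Stated for a mixture of the events and of their complements, so that the
   complements can be introduced one at a time. *)
Lemma probability_mixed_complements h (E : 'I_h -> set Omega) (p : R) :
  (forall i, measurable (E i)) ->
  (forall J : {set 'I_h}, P (\bigcap_(i in [set` J]) E i) = (p ^+ #|J|)%:E) ->
  forall n (K : {set 'I_h}), (n <= h)%N -> (forall i, i \in K -> (n <= i)%N) ->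
  P (\bigcap_(i in [set i : 'I_h | (i < n)%N]) ~` E i `&`
     \bigcap_(i in [set` K]) E i) = ((1 - p) ^+ n * p ^+ #|K|)%:E.
Proof.
move=> mE PE; elim=> [|n IHn] K nh nK.
  rewrite (_ : [set i : 'I_h | (i < 0)%N] = set0); last by apply/seteqP; split.
  by rewrite bigcap_set0 setTI PE expr0 mul1r.
pose i0 := Ordinal nh; have i0K : i0 \notin K.
  by apply/negP => /nK; rewrite ltnn.
set A := \bigcap_(i in [set i : 'I_h | (i < n)%N]) ~` E i.
set B := \bigcap_(i in [set` K]) E i.
have mA : measurable A.
  by apply: fin_bigcap_measurable => // i _; exact: measurableC.
have mB : measurable B by apply: fin_bigcap_measurable.
have -> : \bigcap_(i in [set i : 'I_h | (i < n.+1)%N]) ~` E i `&` B =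
    (A `&` B) `\` E i0.
  apply/seteqP; split => [w [AEw Bw]|w [[Aw Bw] Ew]]; split => //.
  - by split => // i /= iN; apply: AEw; exact: ltnW.
  - exact: (AEw i0 (ltnSn n)).
  - move=> i /=; rewrite ltnS leq_eqVlt => /orP[/eqP iN|]; last exact: Aw.
    by rewrite (_ : i = i0)//; exact: val_inj.
have nK' i : i \in K -> (n <= i)%N by move/nK/ltnW.
have AB : P (A `&` B) = ((1 - p) ^+ n * p ^+ #|K|)%:E by apply: IHn => //; exact: ltnW.
(* The complement of [E i0] is introduced by subtraction: the subtracted term is the induction
   hypothesis with [i0] added to [K], which costs one factor [p]. *)
have -> : P ((A `&` B) `\` E i0) = (P (A `&` B) - P (A `&` B `&` E i0))%E.
  apply: measureD => //; first exact: measurableI.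
  by rewrite (le_lt_trans (probability_le1 _ (measurableI _ _ mA mB))) ?ltry.
rewrite -setIA [B `&` _](_ : _ = \bigcap_(i in [set` i0 |: K]) E i); last first.
  apply/seteqP; split => [w [Bw Ew] i /=|w BEw].
    by rewrite in_setU1 => /orP[/eqP->//|]; exact: Bw.
  split; last by apply: BEw; rewrite /= setU11.
  by move=> i iK; apply: BEw; rewrite /= setU1r.
rewrite AB [X in (_ - X)%E](_ : _ = ((1 - p) ^+ n * p ^+ #|i0 |: K|)%:E).
  by rewrite -EFinB cardsU1 i0K !exprS; congr _%:E; ring.
by apply: IHn; [exact: ltnW|move=> i; rewrite in_setU1 => /orP[/eqP->|/nK']].
Qed.

Lemma probability_bigcap_complements h (E : 'I_h -> set Omega) (p : R) :
  (forall i, measurable (E i)) ->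
  (forall J : {set 'I_h}, P (\bigcap_(i in [set` J]) E i) = (p ^+ #|J|)%:E) ->
  P (\bigcap_i ~` E i) = ((1 - p) ^+ h)%:E.
Proof.
move=> mE PE.
have := probability_mixed_complements mE PE (leqnn h) (K := finset.set0).
rewrite (_ : [set i : 'I_h | (i < h)%N] = setT); last first.
  by apply/seteqP; split => // i _ /=.
rewrite [X in _ `&` X](_ : _ = setT); last first.
  by apply/seteqP; split => // w _ i /=; rewrite inE.
rewrite setIT cards0 expr0 mulr1; apply => i; by rewrite inE.
Qed.

Lemma neuron_coord_subproof h d (i : 'I_h) (l : 'I_d.+1) :
  ((if (l < d)%N then i * d + l else h * d + i) < h * d + h)%N.
Proof. by have := ltn_ord i; have := ltn_ord l; case: ifPn; nia. Qed.

(* [ord_max] gives the bias of the neuron. *)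
Definition neuron_coord h d (i : 'I_h) (l : 'I_d.+1) : 'I_(h * d + h) :=
  Ordinal (neuron_coord_subproof i l).

Lemma neuron_coord_inj h d :
  injective (fun u : 'I_h * 'I_d.+1 => neuron_coord u.1 u.2).
Proof.
move=> [i l] [i' l'] /(congr1 val)/=.
have := ltn_ord i; have := ltn_ord l; have := ltn_ord i'; have := ltn_ord l'.
move=> hl' hi' hl hi E.
suff : i = i' :> nat /\ l = l' :> nat by move=> [/val_inj-> /val_inj->].
have lt_hd (k m : nat) : (k < h)%N -> (m < d)%N -> (k * d + m < h * d)%N by nia.
move: E; case: ifPn => ld; case: ifPn => ld' E.
- have d_gt0 : (0 < d)%N by rewrite (leq_trans _ ld).
  have ii' : i = i' :> nat.
    have /(congr1 (divn^~ d)) := E.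
    by rewrite !divnMDl// !divn_small// !addn0.
  by split=> //; move: E; rewrite ii'; lia.
- by have := lt_hd _ _ hi ld; lia.
- by have := lt_hd _ _ hi' ld'; lia.
- by lia.
Qed.

(** Distinct pairs of a neuron and a position name distinct parameters, so independence gives one
    product over all pairs; the [d] weights and the bias of a neuron contribute [pw ^+ d * pb]. *)
Lemma independent_neurons d h (xi : 'I_(h * d + h) -> Omega -> R)
    (W B : set R) (pw pb : R) :
  mutually_independent P xi -> measurable W -> measurable B ->
  (forall c : 'I_(h * d + h), P (xi c @^-1` W) = pw%:E) ->
  (forall c : 'I_(h * d + h), P (xi c @^-1` B) = pb%:E) ->
  forall J : {set 'I_h},
  P (\bigcap_(i in [set` J]) \bigcap_l
       (xi (neuron_coord i l) @^-1` (if (l < d)%N then W else B))) =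
  ((pw ^+ d * pb) ^+ #|J|)%:E.
Proof.
move=> indep mW mB PW PB J.
pose A (c : 'I_(h * d + h)) := if (c < h * d)%N then W else B.
have AE i (l : 'I_d.+1) : A (neuron_coord i l) = if (l < d)%N then W else B.
  rewrite /A /=; case: (ltnP l d) => ld; last by rewrite ifF//; lia.
  by rewrite ifT//; have := ltn_ord i; nia.
have := indep [set neuron_coord u.1 u.2 | u in finset.setX J [set: 'I_d.+1]]%SET A.
rewrite big_imset/=; last by move=> ? ? _ _; exact: neuron_coord_inj.
have -> : \bigcap_(i in [set` [set neuron_coord u.1 u.2 |
              u in finset.setX J [set: 'I_d.+1]]%SET]) xi i @^-1` A i =
    \bigcap_(i in [set` J]) \bigcap_l
      (xi (neuron_coord i l) @^-1` (if (l < d)%N then W else B)).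
  apply/seteqP; split => [w Hw i iJ l _|w Hw c /= /imsetP[[i l]]].
    rewrite -(AE i l); apply: Hw => /=; apply/imsetP.
    by exists (i, l) => //; rewrite !inE andbT.
  by rewrite !inE andbT => iJ -> /=; rewrite AE; exact: (Hw i iJ l).
move=> ->; last by move=> c; rewrite /A; case: ifPn.
pose F (l : 'I_d.+1) := if (l < d)%N then pw else pb.
transitivity (\prod_(u in finset.setX J [set: 'I_d.+1]%SET) (F u.2)%:E)%E.
  by apply: eq_bigr => -[i l] _ /=; rewrite AE /F; case: ifPn.
rewrite prodEFin; congr _%:E.
transitivity (\prod_(i in J) \prod_(l < d.+1) F l).
  rewrite pair_big/=; apply: eq_bigl => -[i l]/=; by rewrite !inE.
rewrite big_ord_recr/= /F ltnn.
under [X in \prod_(_ in _) (X * _)]eq_bigr do rewrite /= ltn_ord.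
by rewrite !prodr_const card_ord.
Qed.

End dead_at_initialization.

(** * Intervals under a law with a density *)

Section law_with_density.
Context {R : realType} {disp : measure_display} {Omega : measurableType disp}.
Variables (P : probability Omega R) (q : R -> R).
Hypotheses (q_ge0 : forall x, 0 <= q x) (q_measurable : measurable_fun setT q).
Local Notation mu := lebesgue_measure.

(** A zero integral would make [q] vanish almost everywhere on the interval, where it is positive;
    the interval would be null, against its length [y - x]. *)
Lemma integral_gt0 (x y : R) : x < y -> (forall t, x <= t < y -> 0 < q t) ->
  (0 < \int[mu]_(t in `[x, y[) (q t)%:E)%E.
Proof.
move=> xy q_gt0; rewrite lt0e integral_ge0 ?andbT; last first.
  by move=> t _; rewrite lee_fin.
apply/negP => /eqP int0; have mq : measurable_fun (`[x, y[ : set R) (EFin \o q).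
  by apply/measurable_EFinP; exact: measurable_funTS.
have : (\int[mu]_(t in `[x, y[) `|(EFin \o q) t|)%E = 0%E.
  by rewrite -int0; apply: eq_integral => t _ /=; rewrite ger0_norm.
move/(ae_eq_integral_abs mu (measurable_itv _) mq) => q0.
have : mu (`[x, y[ : set R) = 0%E.
  apply: measure_negligible => //; move: q0; apply: negligibleS => t /=.
  rewrite in_itv/= => xty /(_ xty) [qt0].
  by have := q_gt0 _ xty; rewrite qt0 ltxx.
by rewrite lebesgue_measure_itv/= lte_fin xy => /eqP; rewrite -EFinB eqe subr_eq0 gt_eqF.
Qed.

Lemma probability_itv_density (xi : Omega -> R) (x y : R) :
  measurable_fun setT xi ->
  (forall z, P [set w | xi w < z] = (\int[mu]_(t in `]-oo, z[) (q t)%:E)%E) ->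
  x <= y ->
  P [set w | x <= xi w < y] = (\int[mu]_(t in `[x, y[) (q t)%:E)%E.
Proof.
move=> mxi law xy.
have mlt z : measurable [set w | xi w < z].
  rewrite (_ : [set _ | _] = xi @^-1` `]-oo, z[); last first.
    by apply/seteqP; split => w /=; rewrite in_itv.
  by rewrite -[_ @^-1` _]setTI; exact: mxi.
have -> : P [set w | x <= xi w < y] =
    (P [set w | xi w < y]%R - P [set w | xi w < x]%R)%E.
  have -> : [set w | x <= xi w < y] =
      [set w | xi w < y] `\` [set w | xi w < x].
    apply/seteqP; split => w /=.
      by move=> /andP[xw ->]; split => //; apply/negP; rewrite -leNgt.
    by move=> [-> /negP]; rewrite -leNgt => ->.
  rewrite measureD//; last by rewrite (le_lt_trans (probability_le1 _ _)) ?ltry.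
  congr (_ - P _)%E; apply/seteqP; split => w /=; first by case.
  by move=> wx; split => //; exact: lt_le_trans xy.
have fin_x : (\int[mu]_(t in `]-oo, x[) (q t)%:E)%E \is a fin_num.
  by rewrite -law; exact: fin_num_measure.
rewrite !law (@itv_bndbnd_setU _ _ -oo%O (BLeft x) (BLeft y))//.
rewrite ge0_integral_setU//=.
- by rewrite addrAC subee// add0e.
- by apply/measurable_EFinP; exact: measurable_funTS.
- by move=> t _; rewrite lee_fin.
- apply/disj_setPS => t /=; rewrite !in_itv/= => -[tx /andP[xt _]].
  by have := le_lt_trans xt tx; rewrite ltxx.
Qed.

End law_with_density.

Lemma open_measurable_borel {R : realType} n (A : set 'rV[R]_n) :
  open A -> measurable (A : set (borel_rV R n)).
Proof. by move=> oA; exact: sub_sigma_algebra. Qed.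

Lemma continuous_measurable_borel {R : realType} n (g : 'rV[R]_n -> R) :
  continuous g -> measurable_fun setT (g : borel_rV R n -> R).
Proof.
move=> cg; apply: (measurability _ (RGenOpens.measurableE R)) => //.
move=> _ [_ [x [y ->] <-]]; rewrite setTI; apply: open_measurable_borel.
by apply: open_comp => [t _|]; [exact: cg|exact: interval_open].
Qed.

Lemma coord_measurable_borel {R : realType} n (j : 'I_n) :
  measurable_fun setT (fun v : borel_rV R n => (v : 'rV[R]_n) 0 j).
Proof. by apply: continuous_measurable_borel; exact: coord_continuous. Qed.

(** [E i] confines the rescaled weights of neuron [i] to [[- eps, eps[] and its rescaled bias to [[-
    eta / 2, - eta / 4[]. On the cube the weights then contribute at most [d * eps * rho = eta / 4],
    which the bias outweighs. The rescaled parameters have the density [q] for every [h], so one [p]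
    serves all widths. *)
Lemma dead_neuron_probability {R : realType} (disp : measure_display)
  (Omega : measurableType disp) (P : probability Omega R) (d : nat)
  (d_gt0 : (0 < d)%N) (a b : R)
  (Theta : forall h, {RV P >-> borel_rV R (dimD d h)})
  (Theta_indep : forall h, (0 < h)%N ->
     mutually_independent P
       (fun (i : 'I_(h * d + h)) (w : Omega) =>
          param (d := d) (h := h) (Theta h w) i))
  (q : R -> R) (q_ge0 : forall x, 0 <= q x)
  (q_measurable : measurable_fun setT q)
  (eta : R) (eta_gt0 : 0 < eta) (q_gt0 : forall x, - eta < x < eta -> 0 < q x)
  (kappa : R)
  (Theta_law : forall h, (0 < h)%N -> forall (i : 'I_(h * d + h)) (x : R),
     P [set w | h%:R `^ kappa * param (d := d) (h := h) (Theta h w) i < x] =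
     (\int[lebesgue_measure]_(y in `]-oo, x[) (q y)%:E)%E) :
  exists p : R, 0 < p /\ forall h, (0 < h)%N ->
    exists E : 'I_h -> set Omega,
    [/\ forall i, measurable (E i),
        forall i w x, E i w -> cube a b d x ->
          preactivation (Theta h w : 'rV[R]_(dimD d h)) i x < 0 &
        P (\bigcap_i ~` E i) = ((1 - p) ^+ h)%:E].
Proof.
(* [rho] bounds the coordinates on the cube; the summand 1 makes it at least 1, whence
   [eps <= eta / 4] and all intervals used lie where [q] is positive. *)
pose rho : R := `|a| + `|b| + 1.
have rho_ge1 : 1 <= rho by rewrite /rho lerDr addr_ge0.
have rho_gt0 : 0 < rho by exact: lt_le_trans rho_ge1.
pose eps : R := eta / (4 * d%:R * rho).
have d_ge1 : 1 <= d%:R :> R by rewrite ler1n.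
have eps_gt0 : 0 < eps by rewrite divr_gt0// !mulr_gt0// (lt_le_trans _ d_ge1).
have epsE : d%:R * (eps * rho) = eta / 4.
  by rewrite /eps; field; rewrite !gt_eqF// (lt_le_trans _ d_ge1).
have eps_le : eps <= eta / 4.
  rewrite -epsE mulrCA ler_peMr ?(ltW eps_gt0)//.
  by apply: le_trans (ler_pM ler01 ler01 d_ge1 rho_ge1); rewrite mul1r.
pose mass x y : R := fine (\int[lebesgue_measure]_(t in `[x, y[) (q t)%:E)%E.
have lawE h (i : 'I_(h * d + h)) x y : (0 < h)%N -> x <= y ->
    P [set w | x <= h%:R `^ kappa *
                 param (d := d) (h := h) (Theta h w) i < y] = (mass x y)%:E.
  move=> h_gt0 xy.
  have mxi : measurable_fun setT (fun w => h%:R `^ kappa *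
      param (d := d) (h := h) (Theta h w) i).
    apply: measurable_funM => //.
    exact: (measurableT_comp (coord_measurable_borel _)).
  have E := probability_itv_density q_ge0 q_measurable mxi (Theta_law _ h_gt0 i) xy.
  rewrite E /mass fineK// -E; apply: fin_num_measure.
  rewrite (_ : [set _ | _] = (fun w => h%:R `^ kappa *
      param (d := d) (h := h) (Theta h w) i) @^-1` `[x, y[); last first.
    by apply/seteqP; split => w /=; rewrite in_itv.
  by rewrite -[_ @^-1` _]setTI; exact: mxi.
(* The law at width 1 identifies the integral with a real number, so that [fine] loses nothing. *)
have mass_gt0 x y : - eta < x -> x < y -> y <= eta -> 0 < mass x y.
  move=> xeta xy yeta; rewrite -lte_fin.
  have d1 : (0 < 1 * d + 1)%N by rewrite addn1.
  have := lawE 1%N (Ordinal d1) x y isT (ltW xy).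
  rewrite (probability_itv_density q_ge0 q_measurable _ (Theta_law _ _ _) (ltW xy))//.
    move=> <-; apply: integral_gt0 => // t /andP[xt ty]; apply: q_gt0.
    by rewrite (lt_le_trans xeta xt) (lt_le_trans ty yeta).
  apply: measurable_funM => //.
  exact: (measurableT_comp (coord_measurable_borel _)).
pose pw := mass (- eps) eps; pose pb := mass (- (eta / 2)) (- (eta / 4)).
exists (pw ^+ d * pb); split.
  by apply: mulr_gt0; [apply: exprn_gt0|]; apply: mass_gt0; lra.
move=> h h_gt0; pose c := h%:R `^ kappa : R.
have c_gt0 : 0 < c by rewrite powR_gt0// ltr0n.
pose W := [set t : R | - eps <= c * t < eps].
pose B := [set t : R | - (eta / 2) <= c * t < - (eta / 4)].
have m_scaled x y : measurable [set t : R | x <= c * t < y].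
  rewrite (_ : [set _ | _] = (fun t => c * t) @^-1` `[x, y[); last first.
    by apply/seteqP; split => w /=; rewrite in_itv.
  by rewrite -[_ @^-1` _]setTI; exact: mulrl_measurable.
pose xi (i : 'I_(h * d + h)) w := param (d := d) (h := h) (Theta h w) i.
have mxi i : measurable_fun setT (xi i).
  exact: (measurableT_comp (coord_measurable_borel _)).
have mWB l : measurable (if (l < d)%N then W else B).
  by case: ifPn => _; exact: m_scaled.
exists (fun i => \bigcap_l
  (xi (neuron_coord i l) @^-1` (if (l < d)%N then W else B))); split.
- move=> i; apply: fin_bigcap_measurable => // l _.
  rewrite -[_ @^-1` _]setTI.
  by apply: mxi => //; exact: mWB.
- move=> i w x dead x_cube.
  have x_le j : `|x 0 j| <= rho.
    have := x_cube j; rewrite /rho; have := ler_norm a; have := ler_norm (- a).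
    have := ler_norm b; have := ler_norm (- b); rewrite !normrN => *.
    by rewrite ler_norml; apply/andP; split; lra.
  (* Multiplication by [c > 0] keeps the sign and turns the parameters into the rescaled ones, whose
     law is known. *)
  rewrite -(pmulr_rlt0 _ c_gt0) /preactivation mulrDr.
  have bias_lt : c * param (Theta h w : 'rV[R]_(dimD d h)) (d * h + i) < - (eta / 4).
    have := dead ord_max I; rewrite /= ltnn /B /xi /= ltnn mulnC.
    by case/andP.
  have weight_le (l : 'I_d) :
      `|c * param (Theta h w : 'rV[R]_(dimD d h)) (i * d + l)| <= eps.
    have := dead (widen_ord (leqnSn d) l) I.
    rewrite /= ltn_ord /W /xi /= ltn_ord => /andP[? ?].
    by rewrite ler_norml; apply/andP; split => //; exact: ltW.
  suff : c * \sum_(j < d) param (Theta h w : 'rV[R]_(dimD d h)) (i * d + j) * x 0 j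
    <= eta / 4 by lra.
  rewrite mulr_sumr -epsE; apply: le_trans (ler_norm _) _.
  apply: le_trans (ler_norm_sum _ _ _) _.
  rewrite (_ : d%:R * _ = \sum_(j < d) (eps * rho)); last first.
    by rewrite sumr_const card_ord mulr_natl.
  apply: ler_sum => j _; rewrite mulrA normrM.
  by apply: ler_pM.
- apply: probability_bigcap_complements => [i|].
    apply: fin_bigcap_measurable => // l _.
    rewrite -[_ @^-1` _]setTI.
    by apply: mxi => //; exact: mWB.
  apply: independent_neurons => //.
  - exact: Theta_indep.
  - exact: m_scaled.
  - exact: m_scaled.
  - by move=> i; rewrite /pw -(lawE _ i)//; lra.
  - by move=> i; rewrite /pb -(lawE _ i)//; lra.
Qed.

(** * Separation of measures by ridge functions *)

Section ramp.
Context {R : realType}.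
Local Notation ramp t := (Num.max t 0 : R).

Lemma ramp_quotient (m : nat) (t e : R) : e != 0 ->
  (ramp (t + e) ^+ m.+1 - ramp t ^+ m.+1) / e =
  (ramp (t + e) - ramp t) / e *
    \sum_(i < m.+1) ramp (t + e) ^+ (m - i) * ramp t ^+ i.
Proof. by move=> e0; rewrite subrXX mulrAC. Qed.

Lemma ramp_increment (t e : R) : 0 <= e -> 0 <= ramp (t + e) - ramp t <= e.
Proof.
move=> e0; rewrite /Num.max; case: ltP => te; case: ltP => t0; lra.
Qed.

(** A bound uniform in [e], used to dominate the difference quotients. In the factored form the
    slope of the ramp is at most 1, and each of the [m.+1] products of powers is at most
    [(T + 1) ^+ m]. *)
Lemma ramp_quotient_le (m : nat) (t e T : R) : `|t| <= T -> 0 < e <= 1 ->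
  `|(ramp (t + e) ^+ m.+1 - ramp t ^+ m.+1) / e| <= m.+1%:R * (T + 1) ^+ m.
Proof.
move=> tT /andP[e0 e1]; rewrite ramp_quotient ?gt_eqF// normrM.
have /andP[inc_ge0 inc_le] := ramp_increment t (ltW e0).
have ramp_le s : `|s| <= T + 1 -> 0 <= ramp s <= T + 1.
  move=> sT; rewrite le_max lexx orbT ge_max /=; apply/andP; split => //.
    exact: le_trans (ler_norm _) sT.
  exact: le_trans (normr_ge0 _) sT.
have /andP[x0 xT] : 0 <= ramp (t + e) <= T + 1.
  by apply: ramp_le; rewrite (le_trans (ler_normD _ _))// (gtr0_norm e0) lerD.
have /andP[y0 yT] : 0 <= ramp t <= T + 1 by apply: ramp_le; rewrite (le_trans tT)// lerDl.
have T0 : 0 <= T + 1 by exact: le_trans xT.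
rewrite -[leRHS]mul1r; apply: ler_pM => //.
  by rewrite ger0_norm ?divr_ge0 ?(ltW e0)// ler_pdivrMr// mul1r.
apply: le_trans (ler_norm_sum _ _ _) _.
rewrite -[X in X%:R * _]card_ord mulr_natl -sumr_const; apply: ler_sum => i _.
have im : (i <= m)%N by rewrite -ltnS.
rewrite [leRHS](_ : _ = (T + 1) ^+ (m - i) * (T + 1) ^+ i); last first.
  by rewrite -exprD subnK.
rewrite ger0_norm ?mulr_ge0 ?exprn_ge0//.
by apply: ler_pM; rewrite ?exprn_ge0// lerXn2r// nnegrE.
Qed.

(** The exponent starts at 2: with exponent 1 the right side would be [ramp t ^+ 0 = 1] also for
    [t < 0], where the quotients are eventually 0. *)
Lemma cvg_ramp_quotient (m : nat) (t : R) :
  (ramp (t + n.+1%:R^-1) ^+ m.+2 - ramp t ^+ m.+2) / n.+1%:R^-1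
    @[n --> \oo] --> m.+2%:R * ramp t ^+ m.+1.
Proof.
have inv0 : n.+1%:R^-1 @[n --> \oo] --> (0 : R) by exact: cvg_harmonic.
have inv_neq0 n : n.+1%:R^-1 != 0 :> R by rewrite invr_neq0.
have [t0|t0] := ltP t 0.
  rewrite !expr0n/= mulr0.
  apply: cvg_near_cst; near=> n.
  have nt : n.+1%:R^-1 < - t by near: n; apply: (cvgr_lt _ inv0); rewrite oppr_gt0.
  have tn : t + n.+1%:R^-1 <= 0 by rewrite -lerBrDl sub0r ltW.
  by rewrite (max_r tn) expr0n/= subrr mul0r.
rewrite (_ : (fun n => _) = (fun n => \sum_(i < m.+2)
    (t + n.+1%:R^-1) ^+ (m.+1 - i) * t ^+ i)); last first.
  apply/funext => n; have := ramp_quotient m.+1 t (inv_neq0 n).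
  have tn : 0 <= t + n.+1%:R^-1 by rewrite addr_ge0// invr_ge0.
  by rewrite (max_l tn) (max_l t0) => ->; rewrite addrAC subrr add0r divff// mul1r.
rewrite (_ : _ * _ = \sum_(i < m.+2) t ^+ (m.+1 - i) * t ^+ i); last first.
  rewrite (eq_bigr (fun=> t ^+ m.+1)); last first.
    by move=> i _; rewrite -exprD subnK// -ltnS.
  by rewrite sumr_const card_ord mulr_natl.
apply: (cvg_big (@add_continuous R)) => i _.
apply: cvgM; last exact: cvg_cst.
have tn : t + n.+1%:R^-1 @[n --> \oo] --> t.
  by rewrite -[X in _ --> X]addr0; apply: cvgD => //; exact: cvg_cst.
exact: (cvg_comp _ (fun x : R => x ^+ (m.+1 - i)) tn (@exprn_continuous _ _ t)).
Unshelve. all: by end_near. Qed.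

(** For [t >= 0] the difference equals 1 for every [n], at the kink [t = 0] too; for [t < 0] both
    ramps vanish once [n * t + 1 <= 0]. *)
Lemma cvg_ramp_heaviside (t : R) :
  ramp (n%:R * t + 1) - ramp (n%:R * t) @[n --> \oo] --> ((0 <= t)%R%:R : R).
Proof.
have [t0|t0] := leP 0 t.
  rewrite (_ : (fun n => _) = cst 1); first exact: cvg_cst.
  apply/funext => n /=; have nt : 0 <= n%:R * t by rewrite mulr_ge0.
  by rewrite !max_l ?addr_ge0// addrAC subrr add0r.
apply: cvg_near_cst; near=> n.
have nt : n%:R * t + 1 <= 0.
  have : (- t)^-1 <= n%:R by near: n; exact: nbhs_infty_ger.
  by rewrite -(@ler_pM2r _ (- t)) ?oppr_gt0// mulVf ?oppr_eq0 ?lt_eqF// mulrN; lra.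
by rewrite !max_r ?subrr//; lra.
Unshelve. all: by end_near. Qed.

Lemma sum_threshold_le (y : R) (N : nat) : 0 <= y <= N%:R ->
  `|\sum_(i < N) (i.+1%:R <= y)%R%:R - y| <= 1.
Proof.
move=> /andP[y0 yN]; set S := fun n => \sum_(i < n) (i.+1%:R <= y)%R%:R : R.
(* [S] counts the positive integers up to [y], that is, it computes the floor. The invariant says
   that either every threshold so far was passed, or the count is already within 1 of [y]. *)
suff [SN SNy [SE|ySN]] : [/\ S N <= N%:R, S N <= y & S N = N%:R \/ y < S N + 1].
- by rewrite -/(S N) ler_norml; apply/andP; split; lra.
- by rewrite -/(S N) ler_norml; apply/andP; split; lra.
rewrite {yN}; elim: N => [|N [SN SNy IH]].
  by rewrite /S big_ord0; split => //; left.
have SS : S N.+1 = S N + (N.+1%:R <= y)%R%:R by rewrite /S big_ord_recr.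
rewrite SS -natr1; move: (S N) SN SNy IH => s SN SNy IH {S SS}.
case: (leP (N%:R + 1) y) => [Ny|yN] /=; rewrite ?mulr1n ?addr0.
  have SNE : s = N%:R.
    case: IH => // ys; have := lt_le_trans (lt_le_trans ys (lerD SN (lexx 1))) Ny.
    by rewrite ltxx.
  by split; [lra|lra|left; lra].
by split; [lra|by []|case: IH => [SNE|]; right; lra].
Qed.

Lemma exp_partial_sum_le (x : R) (n : nat) :
  `|series (exp_coeff x) n| <= expR `|x|.
Proof.
apply: le_trans (ler_norm_sum _ _ _) _.
have -> : \sum_(0 <= i < n) `|exp_coeff x i| = series (exp_coeff `|x|) n.
  by apply: eq_bigr => i _; rewrite /exp_coeff/= normf_div normrX normr_nat.
rewrite /expR; apply: nondecreasing_cvgn_le; last exact: is_cvg_series_exp_coeff.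
apply/nondecreasing_seqP => k; rewrite /series/= big_nat_recr//= lerDl.
by rewrite /exp_coeff/= divr_ge0// exprn_ge0.
Qed.

Lemma cvg_exp_cutoff (y : R) : y < 0 ->
  expR (n%:R * (n%:R * y + 1)) @[n --> \oo] --> (0 : R).
Proof.
move=> y0; apply: (@squeeze_cvgr _ _ _ _ (cst 0) (fun n => n.+1%:R^-1)).
- near=> n; rewrite expR_ge0/= -[X in expR X]opprK expRN lef_pV2 ?posrE ?expR_gt0//.
  apply: le_trans (expR_ge1Dx _); rewrite -natr1 addrC lerD2l -mulrN.
  rewrite -[leLHS]mulr1 ler_wpM2l//.
  (* Beyond this rank [n * y + 1 <= -1], so the whole exponent is at most [- n]. *)
  have : 2 / (- y) <= n%:R by near: n; exact: nbhs_infty_ger.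
  by rewrite ler_pdivrMr ?oppr_gt0//; lra.
- exact: cvg_cst.
- exact: cvg_harmonic.
Unshelve. all: by end_near. Qed.

(* The correction [+ 1] makes the limit vanish also on the boundary [y = 0]. *)
Lemma cvg_box_cutoff (d : nat) (y : 'I_d -> R) :
  expR (- \sum_(j < d) expR (n%:R * (n%:R * y j + 1))) @[n --> \oo] -->
  ([forall j, y j < 0]%:R : R).
Proof.
case: (boolP [forall j, y j < 0]) => [/forallP y0|].
  have S0 : \sum_(j < d) expR (n%:R * (n%:R * y j + 1)) @[n --> \oo] -->
      \sum_(j < d) (0 : R).
    by apply: (cvg_big (@add_continuous R)) => j _; exact: cvg_exp_cutoff.
  rewrite big1// in S0.
  have := cvg_comp _ expR (cvgN S0) (@continuous_expR R (- 0)).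
  by rewrite oppr0 expR0; apply.
rewrite negb_forall => /existsP[j]; rewrite -leNgt => yj.
apply: (@squeeze_cvgr _ _ _ _ (cst 0) (fun n => n.+1%:R^-1)).
- near=> n; rewrite expR_ge0/= expRN lef_pV2 ?posrE ?expR_gt0//.
  apply: le_trans (expR_ge1Dx _); rewrite -natr1 addrC lerD2l.
  rewrite (bigD1 j)//= -[leLHS]addr0; apply: lerD.
    have : n%:R <= n%:R * (n%:R * y j + 1) by rewrite ler_peMr// lerDr mulr_ge0.
    rewrite -ler_expR; apply: le_trans.
    by apply: le_trans (expR_ge1Dx _); rewrite lerDr.
  by apply: sumr_ge0 => i _; exact: expR_ge0.
- exact: cvg_cst.
- exact: cvg_harmonic.
Unshelve. all: by end_near. Qed.

End ramp.

(** * Functions orthogonal to an integrable [Z] *)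

Section annihilator.
Context {R : realType} {disp : measure_display} {Omega : measurableType disp}.
Variables (P : {measure set Omega -> \bar R}) (Z : Omega -> R).
Hypothesis Z_integrable : P.-integrable setT (EFin \o Z).

(** Orthogonality for the pairing of integrable with bounded functions. Measurability and
    boundedness belong to the notion, so that it is stable under linear combinations and uniformly
    bounded pointwise limits. *)
Definition annihilated (u : Omega -> R) : Prop :=
  [/\ measurable_fun setT u, exists K, forall w, `|u w| <= K &
      (\int[P]_w (Z w * u w)%:E = 0)%E].

Lemma integrable_mul_bounded (u : Omega -> R) :
  measurable_fun setT u -> (exists K, forall w, `|u w| <= K) ->
  P.-integrable setT (EFin \o (fun w => Z w * u w)).
Proof.
move=> mu [K uK]; apply: (integrableMl _ Z_integrable mu) => //.
exists K; split; first exact: num_real.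
by move=> x Kx w _ /=; rewrite (le_trans (uK w))// ltW.
Qed.

Lemma annihilated_scale (c : R) u :
  annihilated u -> annihilated (fun w => c * u w).
Proof.
move=> [mu uK u0]; split.
- exact: measurable_funM.
- have [K uKK] := uK; exists (`|c| * K) => w.
  by rewrite normrM ler_wpM2l.
- under eq_integral do rewrite mulrCA EFinM.
  by rewrite integralZl// ?u0 ?mule0//; exact: integrable_mul_bounded.
Qed.

Lemma annihilated_add u v :
  annihilated u -> annihilated v -> annihilated (fun w => u w + v w).
Proof.
move=> [mu uK u0] [mv vK v0]; split.
- exact: measurable_funD.
- have [K uKK] := uK; have [K' vK'] := vK; exists (K + K') => w.
  by rewrite (le_trans (ler_normD _ _))// lerD.
- under eq_integral do rewrite mulrDr EFinD.
  rewrite integralD_EFin//; [|exact: integrable_mul_bounded..].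
  by rewrite u0 v0 adde0.
Qed.

Lemma annihilated0 : annihilated (cst 0).
Proof.
split; first exact: measurable_cst.
  by exists 0 => w; rewrite /= normr0.
by under eq_integral do rewrite mulr0; rewrite integral0.
Qed.

Lemma annihilated_sum (I : Type) (s : seq I) (u : I -> Omega -> R) :
  (forall i, annihilated (u i)) -> annihilated (fun w => \sum_(i <- s) u i w).
Proof.
move=> au; elim: s => [|i s IH].
  by under eq_fun do rewrite big_nil; exact: annihilated0.
by under eq_fun do rewrite big_cons; exact: annihilated_add.
Qed.

(** Dominated convergence with majorant [K * |Z|]. Each later enlargement of the orthogonal family
    passes through this closure property. *)
Lemma annihilated_lim (u_ : nat -> Omega -> R) (u : Omega -> R) (K : R) :
  (forall n, annihilated (u_ n)) -> (forall n w, `|u_ n w| <= K) ->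
  (forall w, u_ n w @[n --> \oo] --> u w) -> annihilated u.
Proof.
move=> au uK cu.
have mu : measurable_fun setT u.
  by apply: (measurable_fun_cvg (h := u_)) => [n|w _]; [case: (au n)|exact: cu].
have uK' w : `|u w| <= K.
  rewrite -(cvg_lim _ (cvg_norm (cu w)))//; apply: limr_le.
    by apply/cvg_ex; exists `|u w|; exact: cvg_norm.
  by apply: nearW => n; exact: uK.
split => //; first by exists K.
have iKZ : P.-integrable setT (fun w => K%:E * `|(Z w)%:E|)%E.
  by apply: integrableZl => //; exact: (integrable_abse Z_integrable).
have [] := @dominated_convergence _ _ _ P setT measurableT
  (fun n w => (Z w * u_ n w)%:E) (fun w => (Z w * u w)%:E)
  (fun w => K%:E * `|(Z w)%:E|)%E.
- move=> n; have [mun uKn _] := au n.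
  exact: measurable_int (integrable_mul_bounded mun uKn).
- by apply: measurable_int (integrable_mul_bounded mu _); exists K.
- apply: aeW => w _; apply: cvg_EFin.
    by apply: nearW => n.
  by apply: cvgM; [exact: cvg_cst|exact: cu].
- exact: iKZ.
- apply: aeW => w n _; rewrite abse_EFin -EFinM lee_fin normrM mulrC.
  by rewrite ler_wpM2r.
move=> _ _; rewrite (_ : [sequence _]_n = cst 0%E); last first.
  by apply/funext => n; have [_ _] := au n.
by move/cvg_lim => <- //; exact: lim_cst.
Qed.

Variables (d : nat) (X : Omega -> 'rV[R]_d) (rho : R).
Hypothesis X_le : forall w j, `|X w 0 j| <= rho.

Definition affine (s : R) (v : 'I_d -> R) (w : Omega) : R :=
  s + \sum_(j < d) v j * X w 0 j.

Lemma affine_le s v : exists T, forall w, `|affine s v w| <= T.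
Proof.
exists (`|s| + \sum_(j < d) `|v j| * rho) => w.
apply: le_trans (ler_normD _ _) _; rewrite lerD2l.
apply: le_trans (ler_norm_sum _ _ _) _; apply: ler_sum => j _.
by rewrite normrM ler_wpM2l.
Qed.

Lemma affine0 w : affine 0 (fun=> 0) w = 0.
Proof. by rewrite /affine add0r big1// => j _; rewrite mul0r. Qed.

Lemma affine_shift s v e w : affine (s + e) v w = affine s v w + e.
Proof. by rewrite /affine addrAC. Qed.

Lemma affine_scale c s v w :
  affine (c * s) (fun j => c * v j) w = c * affine s v w.
Proof.
rewrite /affine mulrDr; congr +%R; rewrite mulr_sumr.
by apply: eq_bigr => j _; rewrite mulrA.
Qed.

Lemma affine_add s v s' v' w :
  affine (s + s') (fun j => v j + v' j) w = affine s v w + affine s' v' w.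
Proof.
rewrite /affine addrACA; congr +%R; rewrite -big_split/=.
by apply: eq_bigr => j _; rewrite mulrDl.
Qed.

(* Differentiating in the bias lowers the exponent. *)
Lemma annihilated_ramp_pred m :
  (forall s v, annihilated (fun w => Num.max (affine s v w) 0 ^+ m.+2)) ->
  forall s v, annihilated (fun w => Num.max (affine s v w) 0 ^+ m.+1).
Proof.
move=> am s v.
have am' : annihilated (fun w => m.+2%:R * Num.max (affine s v w) 0 ^+ m.+1).
  have [T sT] := affine_le s v.
  apply: (@annihilated_lim (fun n w =>
      (Num.max (affine s v w + n.+1%:R^-1) 0 ^+ m.+2 -
       Num.max (affine s v w) 0 ^+ m.+2) / n.+1%:R^-1) _
      (m.+2%:R * (T + 1) ^+ m.+1)).
  - move=> n; under eq_fun do rewrite mulrC -affine_shift -mulN1r.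
    apply: annihilated_scale; apply: annihilated_add => //.
    exact: annihilated_scale.
  - move=> n w; apply: ramp_quotient_le => //.
    by rewrite invr_gt0 ltr0n/= invf_le1 ?ltr0n// ler1n.
  - by move=> w; exact: cvg_ramp_quotient.
have := annihilated_scale m.+2%:R^-1 am'.
by under eq_fun do rewrite mulKf//.
Qed.

Lemma annihilated_ramp k : (0 < k)%N ->
  (forall s v, annihilated (fun w => Num.max (affine s v w) 0 ^+ k)) ->
  forall s v, annihilated (fun w => Num.max (affine s v w) 0).
Proof.
case: k => // k _; elim: k => [|k IH] ak; last first.
  by apply: IH; exact: annihilated_ramp_pred.
by move=> s v; have := ak s v; under eq_fun do rewrite expr1.
Qed.

Hypothesis annihilated_relu :
  forall s v, annihilated (fun w => Num.max (affine s v w) 0).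

Lemma annihilated_halfspace s v :
  annihilated (fun w => (0 <= affine s v w)%R%:R).
Proof.
apply: (@annihilated_lim (fun n w => Num.max (n%:R * affine s v w + 1) 0 -
  Num.max (n%:R * affine s v w) 0) _ 1).
- move=> n; under eq_fun do rewrite -affine_scale -affine_shift -mulN1r.
  by apply: annihilated_add => //; exact: annihilated_scale.
- move=> n w; have /andP[? ?] := ramp_increment (n%:R * affine s v w) ler01.
  by rewrite ger0_norm.
- by move=> w; exact: cvg_ramp_heaviside.
Qed.

(* [exp t] is the limit of [floor ((n+1) exp t) / (n+1)], and the floor counts
   the halfspaces [ln (i / (n+1)) <= t]. *)
Lemma annihilated_expR s v : annihilated (fun w => expR (affine s v w)).
Proof.
have [T sT] := affine_le s v.
(* Enough thresholds for every [w] at once: [expR T] bounds the exponential, and [N n] exceeds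
   [(n + 1) * expR T]. *)
pose N n := (Num.truncn (n.+1%:R * expR T)).+1.
pose count n w := \sum_(i < N n) (i.+1%:R <= n.+1%:R * expR (affine s v w))%R%:R : R.
have countE n w : `|count n w - n.+1%:R * expR (affine s v w)| <= 1.
  apply: sum_threshold_le; rewrite mulr_ge0 ?expR_ge0//=.
  apply: (@le_trans _ _ (n.+1%:R * expR T)).
    by rewrite ler_wpM2l// ler_expR (le_trans (ler_norm _)).
  by rewrite ltW// /N truncnS_gt// mulr_ge0 ?expR_ge0.
have quotE n w : `|n.+1%:R^-1 * count n w - expR (affine s v w)| <= n.+1%:R^-1.
  rewrite -[expR _](mulKf (_ : n.+1%:R != 0))// -mulrBr normrM.
  by rewrite ger0_norm ?invr_ge0// ler_piMr ?invr_ge0.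
apply: (@annihilated_lim (fun n w => n.+1%:R^-1 * count n w) _ (expR T + 1)).
- move=> n; apply: annihilated_scale; apply: annihilated_sum => i.
  rewrite (_ : (fun w => _) =
      (fun w => (0 <= affine (s - ln (i.+1%:R / n.+1%:R)) v w)%R%:R)).
    exact: annihilated_halfspace.
  apply/funext => w; congr (nat_of_bool _)%:R.
  rewrite affine_shift subr_ge0 -[in RHS]ler_expR lnK ?posrE ?divr_gt0//.
  by rewrite ler_pdivrMr// mulrC.
- move=> n w; have := quotE n w; have := expR_ge0 (affine s v w).
  have : expR (affine s v w) <= expR T by rewrite ler_expR (le_trans (ler_norm _)).
  have : n.+1%:R^-1 <= 1 :> R by rewrite invf_le1 ?ltr0n// ler1n.
  move=> n1 eT e0 q; rewrite -[X in `|X|](subrK (expR (affine s v w))).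
  apply: le_trans (ler_normD _ _) _; rewrite addrC (ger0_norm e0) lerD//.
  exact: le_trans q n1.
- move=> w; apply/cvgrPdist_le => e e0; near=> n; rewrite distrC.
  apply: le_trans (quotE n w) _; apply: ltW; near: n.
  exact: (cvgr_lt _ (@cvg_harmonic R)).
Unshelve. all: by end_near. Qed.

(** A strengthening of [annihilated] by a free exponential factor, which lets an induction on powers
    of exponential sums go through. *)
Definition exp_annihilated (u : Omega -> R) : Prop :=
  forall s v, annihilated (fun w => u w * expR (affine s v w)).

Lemma exp_annihilated1 : exp_annihilated (cst 1).
Proof.
by move=> s v; under eq_fun do rewrite mul1r; exact: annihilated_expR.
Qed.

Lemma exp_annihilated_annihilated u : exp_annihilated u -> annihilated u.
Proof.
move=> /(_ 0 (fun=> 0)); rewrite (_ : (fun w => _) = u)//.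
by apply/funext => w; rewrite affine0 expR0 mulr1.
Qed.

Section exp_sum.
Variables (m : nat) (s_ : 'I_m -> R) (v_ : 'I_m -> 'I_d -> R).
Let U w := \sum_(i < m) expR (affine (s_ i) (v_ i) w).

(** A product of exponentials of affine functions is again one: each further factor [U] is expanded
    and absorbed into the free exponential. *)
Lemma exp_annihilated_sumX n : exp_annihilated (fun w => U w ^+ n).
Proof.
elim: n => [|n IH]; first by under eq_fun do rewrite expr0; exact: exp_annihilated1.
move=> s v; rewrite (_ : (fun w => _) = (fun w => \sum_(i < m)
    U w ^+ n * expR (affine (s_ i + s) (fun j => v_ i j + v j) w))).
  by apply: annihilated_sum => i; exact: IH.
apply/funext => w; rewrite exprSr -mulrA /U mulr_suml mulr_sumr.
by apply: eq_bigr => i _; rewrite affine_add expRD.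
Qed.

(** The power series of the exponential at [- U], term by term; as [U] is bounded, the partial sums
    are bounded uniformly. *)
Lemma exp_annihilated_exp_sum : exp_annihilated (fun w => expR (- U w)).
Proof.
move=> s v; have [T sT] := affine_le s v.
have [K UK] : exists K : R, forall w, `|U w| <= K.
  have /choice[K sK] : forall i, exists K : R, forall w, `|affine (s_ i) (v_ i) w| <= K.
    by move=> i; exact: affine_le.
  exists (\sum_(i < m) expR (K i)) => w; apply: le_trans (ler_norm_sum _ _ _) _.
  apply: ler_sum => i _; rewrite ger0_norm ?expR_ge0// ler_expR.
  exact: le_trans (ler_norm _) _.
apply: (@annihilated_lim (fun n w => series (exp_coeff (- U w)) n *
  expR (affine s v w)) _ (expR K * expR T)).
- move=> n; rewrite (_ : (fun w => _) = (fun w => \sum_(0 <= i < n)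
      ((-1) ^+ i / i`!%:R) * (U w ^+ i * expR (affine s v w)))).
    apply: annihilated_sum => i; apply: annihilated_scale.
    exact: exp_annihilated_sumX.
  apply/funext => w; rewrite /series/= mulr_suml; apply: eq_bigr => i _.
  by rewrite /exp_coeff/= (exprNn (U w)) [_ * _ / _]mulrAC !mulrA.
- move=> n w; rewrite normrM; apply: ler_pM => //.
    by apply: le_trans (exp_partial_sum_le _ _) _; rewrite ler_expR normrN.
  by rewrite ger0_norm ?expR_ge0// ler_expR (le_trans (ler_norm _)).
- by move=> w; apply: cvgM; [exact: is_cvg_series_exp_coeff|exact: cvg_cst].
Qed.

End exp_sum.

Lemma annihilated_box (c : 'I_d -> R) :
  annihilated (fun w => [forall j, X w 0 j < c j]%:R).
Proof.
apply: (@annihilated_lim (fun n w =>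
  expR (- \sum_(j < d) expR (n%:R * (n%:R * (X w 0 j - c j) + 1)))) _ 1).
- move=> n; apply: exp_annihilated_annihilated.
  (* Expanded, the exponent [n * (n * (x_j - c_j) + 1)] is affine with constant [n * (1 - n * c_j)]
     and the single slope [n * n] in direction [j]. *)
  have := @exp_annihilated_exp_sum d (fun j => n%:R * (1 - n%:R * c j))
    (fun j l => if l == j then n%:R * n%:R else 0).
  congr exp_annihilated; apply/funext => w; congr (expR (- _)).
  apply: eq_bigr => j _; congr expR; rewrite /affine (bigD1 j)//= eqxx.
  rewrite big1 => [|l /negbTE ->]; last by rewrite mul0r.
  by rewrite addr0; ring.
- move=> n w; rewrite ger0_norm ?expR_ge0// -expR0 ler_expR oppr_le0.
  by apply: sumr_ge0 => j _; exact: expR_ge0.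
- move=> w; rewrite (_ : [forall j, X w 0 j < c j] = [forall j, X w 0 j - c j < 0]).
    exact: cvg_box_cutoff.
  by apply: eq_forallb => j; rewrite subr_lt0.
Qed.

End annihilator.

Lemma countable_bigcup_measurable_type d (T : measurableType d) (I : countType)
    (F : I -> set T) :
  (forall i, measurable (F i)) -> measurable (\bigcup_i F i).
Proof.
move=> mF; rewrite (_ : \bigcup_i F i =
    \bigcup_n (if unpickle n is Some i then F i else set0)).
  by apply: bigcupT_measurable => n; case: unpickle.
apply/seteqP; split => [x [i _ Fix]|x [n _]].
  by exists (pickle i) => //; rewrite pickleK.
by case: unpickle => // i Fix; exists i.
Qed.

(** * Lower orthants generate the Borel sets *)

Section open_boxes.
Context {R : realType} {d : nat}.

Definition open_box (c : 'I_d -> R) : set 'rV[R]_d :=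
  [set x | forall j, x 0 j < c j].

Lemma open_box_setI : setI_closed (range open_box).
Proof.
move=> _ _ [c _ <-] [c' _ <-]; exists (fun j => Num.min (c j) (c' j)) => //.
apply/seteqP; split => x /= xc.
  by split => j; have := xc j; rewrite lt_min => /andP[].
by case: xc => xc xc' j; rewrite lt_min xc xc'.
Qed.

(** An open set is the union of the rational cubes that it contains, of which there are countably
    many; each is cut out by coordinate halfspaces. *)
Lemma borel_rV_open_box :
  @measurable _ (borel_rV R d) = <<s range open_box >>.
Proof.
apply/seteqP; split; last first.
  apply: smallest_sub; first exact: smallest_sigma_algebra.
  move=> _ [c _ <-].
  rewrite (_ : open_box c = \bigcap_(j in [set: 'I_d])
      (fun x : borel_rV R d => (x : 'rV[R]_d) 0 j) @^-1` `]-oo, c j[); last first.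
    by apply/seteqP; split => x /= xc j => [_|]; have := xc j; rewrite /= in_itv/=; apply.
  apply: fin_bigcap_measurable => // j _; rewrite -[_ @^-1` _]setTI.
  exact: coord_measurable_borel.
apply: smallest_sub; first exact: smallest_sigma_algebra.
move=> U oU; pose T := g_sigma_algebraType (range open_box).
suff : @measurable _ T U by [].
have m_half j c : @measurable _ T [set x : 'rV[R]_d | x 0 j < c].
  (* A halfspace is an increasing union of orthants whose other bounds tend to infinity. *)
  rewrite (_ : [set _ | _] =
      \bigcup_n open_box (fun l => if l == j then c else n%:R)).
    by apply: bigcupT_measurable => n; apply: sub_sigma_algebra; eexists.
  apply/seteqP; split => [x /= xc|x [n _ /(_ j)]]; last by rewrite eqxx.
  exists (Num.truncn (\sum_(l < d) `|x 0 l|)).+1 => // l; case: eqP => [->//|_].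
  apply: le_lt_trans (truncnS_gt _); rewrite (bigD1 l)//=.
  by rewrite (le_trans (ler_norm _))// lerDl sumr_ge0.
(* Half-open cubes with rational centre [u.1] and rational radius [u.2]. *)
pose C (u : 'rV[rat]_d * rat) : set T := \bigcap_(j in [set: 'I_d])
  ([set x : 'rV[R]_d | x 0 j < ratr (u.1 0 j) + ratr u.2] `\`
   [set x : 'rV[R]_d | x 0 j < ratr (u.1 0 j) - ratr u.2]).
have -> : U = \bigcup_u (if `[< C u `<=` U >] then C u else set0).
  apply/seteqP; split => [x Ux|x [u _]]; last first.
    by case: ifPn => [/asboolP|//]; apply.
  have /nbhs_ballP[e /= e0 eU] : nbhs x U by exact: open_nbhs_nbhs.
  (* With a radius below [e / 2], a cube around a rational point close to [x] stays within distance
     [e] of [x]. *)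
  have [r] := rat_in_itvoo (divr_gt0 e0 (ltr0n _ 2)).
  rewrite in_itv/= => /andP[r0 re].
  have /choice[q qx] : forall j, exists q : rat, `|x 0 j - ratr q| < ratr r.
    move=> j; have : x 0 j - ratr r < x 0 j + ratr r by lra.
    move=> /rat_in_itvoo[q]; rewrite in_itv/= => /andP[? ?].
    by exists q; rewrite ltr_norml; apply/andP; split; lra.
  have xC : C (\row_j q j, r) x.
    move=> j _; have := qx j; rewrite ltr_norml => /andP[? ?] /=; rewrite !mxE.
    by split; [lra|apply/negP; rewrite -leNgt; lra].
  exists (\row_j q j, r) => //; rewrite ifT//; apply/asboolP => y yC.
  apply: eU; split => // i j; rewrite ord1.
  have [/= /[!mxE] yr /negP] := yC j I; rewrite -leNgt => yr'.
  have := qx j; rewrite ltr_norml => /andP[? ?].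
  by rewrite /ball/= ltr_norml; apply/andP; split; lra.
apply: countable_bigcup_measurable_type => u; case: ifPn => _ //.
by apply: fin_bigcap_measurable => // j _; apply: measurableD; exact: m_half.
Qed.

End open_boxes.

Section ridge_density.
Context {R : realType} {disp : measure_display} {Omega : measurableType disp}.
Variables (P : {measure set Omega -> \bar R}) (Z : Omega -> R).
Hypothesis Z_integrable : P.-integrable setT (EFin \o Z).
Variables (d : nat) (X : Omega -> 'rV[R]_d) (rho : R).
Hypothesis mX : measurable_fun setT (X : Omega -> borel_rV R d).
Hypothesis X_le : forall w j, `|X w 0 j| <= rho.

(* Ridge functions [max (s + v . x) 0 ^ k] separate finite signed measures on
   bounded sets. *)
Lemma integral_preimage_eq0 k : (0 < k)%N ->
  (forall s v, annihilated P Z (fun w => Num.max (affine X s v w) 0 ^+ k)) ->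
  forall B : set (borel_rV R d), measurable B ->
  (\int[P]_(w in X @^-1` B) (Z w)%:E = 0)%E.
Proof.
move=> k0 ann B mB.
have relu := annihilated_ramp Z_integrable X_le k0 ann.
have mpre (S : set (borel_rV R d)) : measurable S -> measurable (X @^-1` S).
  by move=> mS; rewrite -[_ @^-1` _]setTI; exact: mX.
have mZ : measurable_fun setT (EFin \o Z) := measurable_int _ Z_integrable.
(* The exponential of the zero function is the constant 1. The vanishing of the total integral is
   what closes the class [Q] under complements. *)
have intT : (\int[P]_w (Z w)%:E = 0)%E.
  have := annihilated_expR Z_integrable X_le relu 0 (fun=> 0).
  move=> [_ _]; by under eq_integral do rewrite affine0 expR0 mulr1.
pose Q (S : set (borel_rV R d)) := (\int[P]_(w in X @^-1` S) (Z w)%:E = 0)%E.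
apply: (dynkin_induction (P := Q) borel_rV_open_box) => //.
- exact: open_box_setI.
- move=> _ [c _ <-].
  have [_ _] := annihilated_box Z_integrable X_le relu c.
  apply: etrans; rewrite integral_mkcond; apply: eq_integral => w _.
  rewrite patchE; case: ifPn => [|]; rewrite ?inE ?notin_setE /open_box/= => Xc.
    by rewrite (_ : [forall j, _]) ?mulr1//; apply/forallP.
  by rewrite (_ : [forall j, _] = false) ?mulr0//; apply/negP => /forallP.
- move=> S mS QS; have := intT.
  rewrite -(setUv (X @^-1` S)) preimage_setC integral_setU//; last first.
  + by apply/disj_setPS => w [].
  + exact: measurable_funTS.
  + exact: mpre (measurableC mS).
  + exact: mpre.
  by rewrite -/(Q S) in QS *; rewrite QS add0e.
- move=> F mF tF QF; rewrite /Q preimage_bigcup integral_bigcup//.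
  + by apply: eseries0 => i _ _; exact: QF.
  + apply/trivIsetP => i j _ _ ij.
    by rewrite -preimage_setI ((trivIsetP.1 tF) i j)// preimage_set0.
  + by move=> i; exact: mpre.
  + apply: integrableS Z_integrable => //.
    by apply: bigcupT_measurable => i; exact: mpre.
- by rewrite -borel_rV_open_box.
Qed.

End ridge_density.

(** * Freezing of dead neurons and comparison of risks *)

Lemma measurable_preactivation {R : realType} d h i disp
    (T : measurableType disp) (theta : T -> borel_rV R (dimD d h))
    (x : T -> borel_rV R d) :
  measurable_fun setT theta -> measurable_fun setT x ->
  measurable_fun setT
    (fun t => preactivation (theta t : 'rV[R]_(dimD d h)) i (x t)).
Proof.
move=> mtheta mx; apply: measurable_funD.
  exact: (measurableT_comp (coord_measurable_borel _)).
apply: measurable_sum => j; apply: measurable_funM.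
  exact: (measurableT_comp (coord_measurable_borel _)).
exact: (measurableT_comp (coord_measurable_borel _)).
Qed.

Lemma measurable_shallow_net {R : realType} d h (sigma : R -> R) disp
    (T : measurableType disp) (theta : T -> borel_rV R (dimD d h))
    (x : T -> borel_rV R d) :
  measurable_fun setT sigma ->
  measurable_fun setT theta -> measurable_fun setT x ->
  measurable_fun setT
    (fun t => shallow_net sigma (theta t : 'rV[R]_(dimD d h)) (x t)).
Proof.
move=> msigma mtheta mx; apply: measurable_funD.
  exact: (measurableT_comp (coord_measurable_borel _)).
apply: measurable_sum => i; apply: measurable_funM.
  exact: (measurableT_comp (coord_measurable_borel _)).
exact: (measurableT_comp msigma (measurable_preactivation _ mtheta mx)).
Qed.

Lemma measurable_ramp_exp {R : realType} k :
  measurable_fun setT (fun x : R => Num.max x 0 ^+ k).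
Proof.
by apply: (measurable_funX _ (measurable_maxr _ _)) => //; exact: measurable_id.
Qed.

Lemma preactivation_eq {R : realType} d h (theta theta' : 'rV[R]_(dimD d h))
    (i : 'I_h) x :
  (forall j : 'I_(dimD d h), neuron_index d i j -> theta 0 j = theta' 0 j) ->
  preactivation theta i x = preactivation theta' i x.
Proof.
move=> eq_on; have ih := ltn_ord i; have idh : (i * d + d <= d * h)%N by nia.
have eq_param m : (m < dimD d h)%N -> neuron_index d i m ->
    param theta m = param theta' m.
  by move=> mD mi; apply: eq_on; rewrite inordK.
congr +%R; first by apply: eq_param; rewrite /dimD /neuron_index ?eqxx ?orbT//; lia.
apply: eq_bigr => j _; congr (_ * _); have jd := ltn_ord j.
by apply: eq_param; rewrite /dimD /neuron_index; lia.
Qed.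

Section frozen_neuron.
Context {R : realType} {d h : nat} (C : set 'rV[R]_d).
Variables (sigma : R -> R) (M : nat -> nat) (xs : nat -> nat -> 'rV[R]_d)
  (ys : nat -> nat -> R) (G : nat -> 'rV[R]_(dimD d h) -> 'rV[R]_(dimD d h))
  (Phi : forall n, 'M[R]_(n.+1, dimD d h) -> 'rV[R]_(dimD d h))
  (theta : nat -> 'rV[R]_(dimD d h)).
Hypotheses (sigma0 : forall t, t <= 0 -> sigma t = 0)
  (xs_C : forall n m, C (xs n m))
  (G_gradient : forall n, generalized_gradient
     (batch_loss sigma (M n) (xs n) (ys n) (h := h)) (G n))
  (Phi_zero : forall n, preserves_zero_coordinates (@Phi n))
  (theta_step : forall n, theta n.+1 = theta n -
     Phi (\matrix_(i < n.+1, j < dimD d h) G i (theta i) 0 j)).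

(** Strong induction, because [Phi] sees the whole history of gradients: as long as the neuron has
    kept its initial preactivation, all these gradients vanish in its coordinates, and hence so does
    the next update. *)
Lemma dead_neuron_frozen (i : 'I_h) :
  (forall x, C x -> preactivation (theta 0) i x < 0) ->
  forall n x, preactivation (theta n) i x = preactivation (theta 0) i x.
Proof.
move=> dead n x; apply: preactivation_eq.
elim/ltn_ind: n => -[//|n] IH j ij.
rewrite theta_step mxE [X in _ + X]mxE Phi_zero ?oppr0 ?addr0; first exact: IH.
apply: big1 => m _; rewrite mxE.
rewrite (gradient_dead_neuron sigma0 (@G_gradient m) _ ij) ?normr0// => l.
by rewrite (preactivation_eq (theta' := theta 0)) ?dead//; exact: IH.
Qed.

End frozen_neuron.

Lemma limn_einf_ge {R : realType} (u : nat -> \bar R) (l : \bar R) :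
  (forall n, (l <= u n)%E) -> (l <= limn_einf u)%E.
Proof.
move=> lu; rewrite limn_einf_lim; apply: lime_ge; first exact: is_cvg_einfs.
by apply: nearW => n; apply: le_ereal_inf_tmp => _ [m _ <-].
Qed.

Lemma positive_null_integral {R : realType} disp (T : measurableType disp)
    (P : {measure set T -> \bar R}) (A : set T) (u : T -> R) :
  measurable A -> measurable_fun A u -> (forall w, A w -> 0 < u w) ->
  (\int[P]_(w in A) (u w)%:E = 0)%E -> P.-negligible A.
Proof.
move=> mA mu u0 int0.
have mEu : measurable_fun A (EFin \o u) by exact/measurable_EFinP.
have : (\int[P]_(w in A) `|(EFin \o u) w| = 0)%E.
  rewrite -int0; apply: eq_integral => w; rewrite inE => Aw /=.
  by rewrite gtr0_norm ?u0.
move/(ae_eq_integral_abs P mA mEu).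
apply: negligibleS => w Aw /= /(_ Aw) [uw].
by have := u0 _ Aw; rewrite uw ltxx.
Qed.

Lemma nonneg_parabola {R : realFieldType} (a b : R) : 0 <= b ->
  (forall t, 0 <= 2 * t * a + t ^+ 2 * b) -> a = 0.
Proof.
(* The denominator [b + 1], instead of the [b] of the exact minimizer, also covers [b = 0]; the
   value there is a negative multiple of [a ^+ 2]. *)
move=> b0 /(_ (- a / (b + 1))).
have b1 : b + 1 != 0 by rewrite gt_eqF// ltr_wpDl.
rewrite (_ : _ + _ = - (a ^+ 2 * ((b + 2) / (b + 1) ^+ 2))); last by field.
rewrite oppr_ge0 pmulr_lle0; last by rewrite divr_gt0 ?exprn_gt0//; lra.
by move=> a2; apply/eqP; rewrite -sqrf_eq0 eq_le a2 sqr_ge0.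
Qed.

Lemma cube_le {R : realType} (a b : R) d (x : 'rV[R]_d) :
  cube a b d x -> forall j, `|x 0 j| <= `|a| + `|b|.
Proof.
move=> xC j; have := xC j; have := ler_norm (- a); have := ler_norm b.
have := normr_ge0 a; have := normr_ge0 b; rewrite normrN => *.
by rewrite ler_norml; apply/andP; split; lra.
Qed.

Lemma measurable_cube {R : realType} (a b : R) d :
  measurable (cube a b d : set (borel_rV R d)).
Proof.
rewrite (_ : cube a b d = \bigcap_(j in [set: 'I_d])
    (fun x : borel_rV R d => (x : 'rV[R]_d) 0 j) @^-1` `[a, b]); last first.
  by apply/seteqP; split => x /= xc j => [_|]; have := xc j; rewrite /= in_itv/=; apply.
apply: fin_bigcap_measurable => // j _; rewrite -[_ @^-1` _]setTI.
exact: coord_measurable_borel.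
Qed.

(** * The risk, its minimizers and the regression function *)

Section risk.
Context {R : realType} {d : nat} {a b : R}.
Context {disp : measure_display} {Omega : measurableType disp}.
Variables (P : probability Omega R) (X : {RV P >-> borel_rV R d}) (Y : {RV P >-> R}).
Variables (k : nat) (sigma : R -> R).
Hypotheses (k_gt0 : (0 < k)%N) (sigmaE : forall x, sigma x = Num.max x 0 ^+ k).
Hypothesis X_cube : forall w, cube a b d (X w).

Definition risk h (theta : 'rV[R]_(dimD d h)) : \bar R :=
  'E_P[fun w => (`|shallow_net sigma theta (X w) - Y w| ^+ 2)%R]%E.

Lemma measurable_sigma : measurable_fun setT sigma.
Proof. by rewrite (funext sigmaE); exact: measurable_ramp_exp. Qed.

Lemma riskE h (theta : 'rV[R]_(dimD d h)) :
  risk theta = (\int[P]_w ((shallow_net sigma theta (X w) - Y w) ^+ 2)%:E)%E.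
Proof.
by rewrite /risk unlock; apply: eq_integral => w _; rewrite real_normK// num_real.
Qed.

Lemma risk_ge0 h (theta : 'rV[R]_(dimD d h)) : (0 <= risk theta)%E.
Proof. by rewrite riskE integral_ge0// => w _; rewrite lee_fin sqr_ge0. Qed.

(** Tonelli, applied to the squared error as a function of parameters and outcome; it makes the
    convergence event measurable. *)
Lemma measurable_risk h :
  measurable_fun setT (@risk h : borel_rV R (dimD d h) -> \bar R).
Proof.
have mf : measurable_fun setT (fun p : borel_rV R (dimD d h) * Omega =>
    ((shallow_net sigma (p.1 : 'rV[R]_(dimD d h)) (X p.2) - Y p.2) ^+ 2)%:E).
  apply/measurable_EFinP; apply: (measurable_funX 2); apply: measurable_funB.
    apply: measurable_shallow_net; [exact: measurable_sigma|exact: measurable_fst|].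
    exact: (measurableT_comp (f := X) _ measurable_snd).
  exact: (measurableT_comp (f := Y) _ measurable_snd).
have mF := measurable_fun_fubini_tonelli_F (m2 := P) _ mf.
apply: eq_measurable_fun (mF _) => [theta _|p]; last by rewrite lee_fin sqr_ge0.
by rewrite riskE.
Qed.

Lemma risk_remove_neuron h (theta : 'rV[R]_(dimD d h.+1)) (i : 'I_h.+1) :
  (forall x, cube a b d x -> preactivation theta i x < 0) ->
  exists theta' : 'rV[R]_(dimD d h), risk theta = risk theta'.
Proof.
move=> dead; have [theta' netE] := shallow_net_remove_neuron sigma theta i.
exists theta'; rewrite !riskE; apply: eq_integral => w _; rewrite netE//.
by rewrite sigmaE max_r ?expr0n -?lt0n ?k_gt0 1?eqn0Ngt ?k_gt0// ltW// dead.
Qed.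

(** First variation: adding a neuron [phi] with outer weight [t] changes the risk by [2 * t *
    E[Z phi] + t ^ 2 * E[phi ^ 2]]. By minimality this is nonnegative for all [t], which forces
    [E[Z phi] = 0]; ridge functions then separate. *)
Lemma residual_integral_eq0 h (theta : 'rV[R]_(dimD d h)) :
  (risk theta < +oo)%E ->
  (forall theta' : 'rV[R]_(dimD d h.+1), (risk theta <= risk theta')%E) ->
  let Z := fun w => shallow_net sigma theta (X w) - Y w in
  P.-integrable setT (EFin \o Z) /\
  forall B : set (borel_rV R d), measurable B ->
    (\int[P]_(w in X @^-1` B) (Z w)%:E = 0)%E.
Proof.
move=> risk_fin risk_min Z.
have mZ : measurable_fun setT Z.
  apply: measurable_funB => //; apply: measurable_shallow_net => //.
  exact: measurable_sigma.
have iZ2 : P.-integrable setT (EFin \o (fun w => Z w ^+ 2)).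
  apply/integrableP; split.
    by apply/measurable_EFinP; exact: (measurable_funX 2).
  rewrite (_ : (\int[P]_w _ = risk theta)%E)// riskE; apply: eq_integral => w _.
  by rewrite /= ger0_norm ?sqr_ge0.
have i1 : P.-integrable setT (EFin \o cst (1 : R)).
  exact: finite_measure_integrable_cst.
(* Square integrability suffices, as [(|z| - 1) ^ 2 >= 0] gives [|z| <= 1 + z ^ 2]. *)
have iZ : P.-integrable setT (EFin \o Z).
  apply: (le_integrable measurableT _ _ (integrableD measurableT i1 iZ2)).
    exact/measurable_EFinP.
  move=> w _; rewrite -[leRHS]/(`|1 + Z w ^+ 2|%:E) lee_fin.
  rewrite [leRHS]ger0_norm ?addr_ge0 ?sqr_ge0//.
  have := sqr_ge0 (`|Z w| - 1).
  rewrite sqrrB expr1n mulr1 mulr2n real_normK ?num_real//.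
  by have := normr_ge0 (Z w); lra.
split => //.
have X_le w j : `|X w 0 j| <= `|a| + `|b| by exact: cube_le.
apply: (integral_preimage_eq0 iZ _ X_le k_gt0) => // s v.
set phi := fun w => Num.max (affine X s v w) 0 ^+ k.
have mphi : measurable_fun setT phi.
  apply: (measurableT_comp (measurable_ramp_exp k)).
  apply: measurable_funD => //; apply: measurable_sum => j.
  apply: measurable_funM => //.
  exact: (measurableT_comp (coord_measurable_borel _)).
have phi_le : exists K, forall w, `|phi w| <= K.
  have [T sT] := affine_le X_le s v; exists (T ^+ k) => w.
  have T0 : 0 <= T by apply: le_trans (sT w).
  rewrite normrX lerXn2r ?nnegrE// ger0_norm ?le_max ?lexx ?orbT// ge_max T0 andbT.
  exact: le_trans (ler_norm _) (sT w).
split => //; have iZphi := integrable_mul_bounded iZ mphi phi_le.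
have iphi2 : P.-integrable setT (EFin \o (fun w => phi w ^+ 2)).
  have [K phiK] := phi_le; apply: measurable_bounded_integrable => //.
  - by rewrite (le_lt_trans (probability_le1 _ _)) ?ltry.
  - exact: (measurable_funX 2).
  - exists (K ^+ 2); split; first exact: num_real.
    move=> x Kx w _ /=; rewrite (le_trans _ (ltW Kx))// normrX lerXn2r ?nnegrE//.
    exact: le_trans (phiK w).
have RE (u : Omega -> R) : P.-integrable setT (EFin \o u) ->
    (\int[P]_w (u w)%:E = (\int[P]_w u w)%:E)%E.
  by move=> iu; rewrite /Rintegral fineK//; exact: integrable_fin_num.
rewrite RE//; congr _%:E.
apply: (@nonneg_parabola _ _ (\int[P]_w (phi w ^+ 2))).
  by apply: Rintegral_ge0 => w _; exact: sqr_ge0.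
move=> t; have [theta' netE] := shallow_net_add_neuron sigma theta t s v.
have iZphit : P.-integrable setT (EFin \o (fun w => 2 * t * (Z w * phi w))).
  exact: (integrableZl measurableT (2 * t) iZphi).
have iphi2t : P.-integrable setT (EFin \o (fun w => t ^+ 2 * phi w ^+ 2)).
  exact: (integrableZl measurableT (t ^+ 2) iphi2).
have iD : P.-integrable setT
    (EFin \o (fun w => 2 * t * (Z w * phi w) + t ^+ 2 * phi w ^+ 2)).
  exact: (integrableD measurableT iZphit iphi2t).
have risk' : (risk theta' = (\int[P]_w
    (Z w ^+ 2 + (2 * t * (Z w * phi w) + t ^+ 2 * phi w ^+ 2)))%:E)%E.
  rewrite riskE -RE; last exact: (integrableD measurableT iZ2 iD).
  apply: eq_integral => w _; congr _%:E.
  by rewrite netE sigmaE -/(affine X s v w) -/(phi w) /Z; ring.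
have := risk_min theta'; rewrite risk' riskE RE// lee_fin.
rewrite RintegralD// RintegralD// RintegralZl// RintegralZl//.
by rewrite lerDl.
Qed.

(* The conditional expectation enters only through its integrals over the
   events [X @^-1` B]. *)
Lemma shallow_net_eq_regression h (theta : 'rV[R]_(dimD d h)) (f : 'rV[R]_d -> R)
    (Z0 : Omega -> R) :
  measurable_fun (cube a b d : set (borel_rV R d)) (f : borel_rV R d -> R) ->
  is_cond_expectation P Y X Z0 -> {ae P, forall w, Z0 w = f (X w)} ->
  (risk theta < +oo)%E ->
  (forall theta' : 'rV[R]_(dimD d h.+1), (risk theta <= risk theta')%E) ->
  risk theta = 'E_P[fun w => (`|f (X w) - Y w| ^+ 2)%R]%E.
Proof.
move=> mf [iY _ iZ0 Z0E] Z0f risk_fin risk_min.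
have [iZ Z_eq0] := residual_integral_eq0 risk_fin risk_min.
have mpre (B : set (borel_rV R d)) : measurable B -> measurable (X @^-1` B).
  by move=> mB; rewrite -[_ @^-1` _]setTI; exact: measurable_funPT.
(* [f] is measurable only on the cube, where all values of [X] lie. *)
have mfX : measurable_fun setT (f \o X).
  move=> _ B mB; rewrite setTI comp_preimage.
  rewrite (_ : _ @^-1` _ = X @^-1` (cube a b d `&` f @^-1` B)).
    by apply: mpre; apply: mf => //; exact: measurable_cube.
  by apply/seteqP; split => w /=; [split|case].
have mN : measurable_fun setT (fun w => shallow_net sigma theta (X w)).
  by apply: measurable_shallow_net => //; exact: measurable_sigma.
set N := fun w => shallow_net sigma theta (X w) in mN *.
have mnet : measurable_fun setT
    (fun x : borel_rV R d => shallow_net sigma theta (x : 'rV[R]_d)).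
  by apply: measurable_shallow_net => //; exact: measurable_sigma.
have iN : P.-integrable setT (EFin \o N).
  rewrite (_ : EFin \o N = (EFin \o Y) \+ (fun w => (N w - Y w)%:E)).
    exact: integrableD.
  by apply/funext => w /=; rewrite -EFinD addrC subrK.
have mZ0 : measurable_fun setT Z0.
  exact/measurable_EFinP/(measurable_int _ iZ0).
have intB_eq0 B (u v : Omega -> R) : measurable B ->
    P.-integrable setT (EFin \o u) -> P.-integrable setT (EFin \o v) ->
    (\int[P]_(w in X @^-1` B) (u w)%:E = \int[P]_(w in X @^-1` B) (v w)%:E)%E ->
    (\int[P]_(w in X @^-1` B) (u w - v w)%:E = 0)%E.
  move=> mB iu iv uv; have mXB := mpre _ mB.
  have iS (g : Omega -> R) : P.-integrable setT (EFin \o g) ->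
      P.-integrable (X @^-1` B) (EFin \o g).
    by move=> ig; exact: (integrableS measurableT).
  under eq_integral do rewrite EFinB.
  rewrite (integralB_EFin mXB (iS _ iu) (iS _ iv)) uv subee//.
  exact: (integrable_fin_num mXB (iS _ iv)).
(* Both sides equal the integral of [Y] over the event: [Z0] by the definition of conditional
   expectation, [N] because the residual [N - Y] integrates to 0 there. *)
have NZ0 B : measurable B ->
    (\int[P]_(w in X @^-1` B) (N w)%:E = \int[P]_(w in X @^-1` B) (Z0 w)%:E)%E.
  move=> mB; rewrite Z0E; last by exists B => //; rewrite setTI.
  have mXB := mpre _ mB; have := Z_eq0 _ mB; under eq_integral do rewrite EFinB.
  rewrite integralB_EFin//; [|exact: (integrableS measurableT)..].
  have := integrable_fin_num mXB (integrableS measurableT mXB (@subsetT _ _) iN).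
  have := integrable_fin_num mXB (integrableS measurableT mXB (@subsetT _ _) iY).
  move=> /fineK <- /fineK <- /eqP.
  by rewrite -EFinB eqe subr_eq0 => /eqP ->.
have int_eq0 B : measurable B ->
    (\int[P]_(w in X @^-1` B) (N w - f (X w))%:E = 0)%E.
  move=> mB; rewrite -(intB_eq0 B N Z0 mB iN iZ0 (NZ0 B mB)).
  apply: ae_eq_integral; [exact: mpre| | |].
  - by apply/measurable_EFinP; apply: measurable_funTS; exact: measurable_funB.
  - by apply/measurable_EFinP; apply: measurable_funTS; exact: measurable_funB.
  - by apply: filterS Z0f => w /= Z0w _; rewrite Z0w.
have int_eq0' B : measurable B ->
    (\int[P]_(w in X @^-1` B) (f (X w) - N w)%:E = 0)%E.
  move=> mB; rewrite -(intB_eq0 B Z0 N mB iZ0 iN (esym (NZ0 B mB))).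
  apply: ae_eq_integral; [exact: mpre| | |].
  - by apply/measurable_EFinP; apply: measurable_funTS; exact: measurable_funB.
  - by apply/measurable_EFinP; apply: measurable_funTS; exact: measurable_funB.
  - by apply: filterS Z0f => w /= Z0w _; rewrite Z0w.
(* To be used for both signs of [N - f]. The event that [r] is positive at [X] is itself of the form
   [X \in B], so [r] has integral 0 over it and the event is null. *)
have neg (r : 'rV[R]_d -> R) :
    measurable_fun (cube a b d : set (borel_rV R d)) (r : borel_rV R d -> R) ->
    (forall B : set (borel_rV R d), measurable B ->
      (\int[P]_(w in X @^-1` B) (r (X w))%:E = 0)%E) ->
    measurable_fun setT (r \o X) ->
    P.-negligible (X @^-1` (cube a b d `&` r @^-1` `]0, +oo[)).
  move=> mr r0 mrX.
  have mB : measurable (cube a b d `&` r @^-1` `]0, +oo[ : set (borel_rV R d)).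
    by apply: mr => //; exact: measurable_cube.
  apply: (@positive_null_integral _ _ _ _ _ (r \o X)); [exact: mpre| | |exact: r0].
    exact: measurable_funTS.
  by move=> w [_] /=; rewrite in_itv/= andbT.
have mnet_f : measurable_fun (cube a b d : set (borel_rV R d))
    (fun x : borel_rV R d => shallow_net sigma theta (x : 'rV[R]_d) - f x).
  by apply: measurable_funB => //; exact: measurable_funTS.
have N1 := neg (fun x => shallow_net sigma theta x - f x) mnet_f int_eq0
  (measurable_funB mN mfX).
have mf_net : measurable_fun (cube a b d : set (borel_rV R d))
    (fun x : borel_rV R d => f x - shallow_net sigma theta (x : 'rV[R]_d)).
  by apply: measurable_funB => //; exact: measurable_funTS.
have N2 := neg (fun x => f x - shallow_net sigma theta x) mf_net int_eq0'
  (measurable_funB mfX mN).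
rewrite /risk unlock; apply: ae_eq_integral => //.
- apply/measurable_EFinP; apply: (measurable_funX 2).
  by apply: measurableT_comp => //; exact: measurable_funB.
- apply/measurable_EFinP; apply: (measurable_funX 2).
  by apply: measurableT_comp => //; exact: measurable_funB.
- have := negligibleU N1 N2; apply: negligibleS => w /= NfX.
  have [Nf|Nf|Nf] := ltgtP (N w) (f (X w)).
  + by right; split => //=; rewrite in_itv/= andbT subr_gt0.
  + by left; split => //=; rewrite in_itv/= andbT subr_gt0.
  + by exfalso; apply: NfX => _; rewrite -/(N w) Nf.
Qed.

End risk.

(** * From a geometric to an exponential bound, and conclusion *)

Lemma expR_tail_bound {R : realType} (p : R) (prob : nat -> \bar R) :
  0 < p -> (0 <= 1 - p)%R ->
  (prob 1%N <= 1)%E ->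
  (forall h, (prob h.+2 <= ((1 - p) ^+ h.+2)%:E)%E) ->
  exists delta : R, 0 < delta /\ forall h, (0 < h)%N ->
    (prob h <= (delta^-1 * expR (- (delta * h%:R)))%:E)%E.
Proof.
(* For widths at least 2, [1 - p <= expR (- p) <= expR (- delta)] suffices. At width 1 only the
   trivial bound 1 is at hand, and [delta <= 1 / 2] makes the right side at least [2 * (1 / 2)]. *)
move=> p0 p1 prob1 probS; exists (Num.min p 2^-1).
have d0 : 0 < Num.min p 2^-1 by rewrite lt_min p0 invr_gt0 ltr0n.
have dp : Num.min p 2^-1 <= p by rewrite ge_min lexx.
have d2 : Num.min p 2^-1 <= 2^-1 by rewrite ge_min lexx orbT.
move: (Num.min p 2^-1) d0 dp d2 => delta d0 dp d2; split => //.
have inv2 : 2 <= delta^-1 by rewrite -[2]invrK lef_pV2 ?posrE// invr_gt0.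
case=> [//|[|h]] _.
  apply: le_trans prob1 _; rewrite lee_fin mulr1.
  have e2 : 2^-1 <= expR (- delta) by apply: le_trans (expR_ge1Dx _); lra.
  rewrite -[leLHS](@divff _ 2)//; apply: ler_pM => //.
apply: le_trans (probS h) _; rewrite lee_fin.
apply: (@le_trans _ _ (expR (- (delta * h.+2%:R)))); last first.
  by rewrite ler_peMl ?expR_ge0//; lra.
rewrite -mulNr expRM_natr; apply: lerXn2r; rewrite ?nnegrE ?expR_ge0//.
apply: le_trans (expR_ge1Dx _); lra.
Qed.

Theorem corollary4p5 (R : realType) (d : nat) (d_gt0 : (0 < d)%N)
  (a b : R) (le_ab : a <= b)
  (mu : {measure set (borel_rV R d) -> \bar R})
  (f : 'rV[R]_d -> R)
  (f_bounded : [bounded f x | x in cube a b d])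
  (f_measurable :
     measurable_fun (cube a b d : set (borel_rV R d))
                    (f : borel_rV R d -> R))
  (k : nat) (k_gt0 : (0 < k)%N)
  (sigma : R -> R) (sigmaE : forall x, sigma x = Num.max x 0 ^+ k)
  (true_loss_fin : forall h (theta : 'rV[R]_(dimD d h)),
     true_loss sigma a b mu f theta \is a fin_num)
  (disp : measure_display) (Omega : measurableType disp)
  (P : probability Omega R)
  (X : nat -> nat -> {RV P >-> borel_rV R d})
  (X_cube : forall m n w, cube a b d (X m n w))
  (Y : nat -> nat -> {RV P >-> R})
  (M : nat -> nat -> nat) (M_gt0 : forall h n, (0 < M h n)%N)
  (G : forall h, nat -> 'rV[R]_(dimD d h) -> Omega -> 'rV[R]_(dimD d h))
  (G_gradient : forall h n w,
     generalized_gradient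
       (batch_loss sigma (M h n) (fun m => X m n w) (fun m => Y m n w) (h := h))
       (fun theta => G h n theta w))
  (Theta : forall h, nat -> {RV P >-> borel_rV R (dimD d h)})
  (Phi : forall h n, 'M[R]_(n.+1, dimD d h) -> 'rV[R]_(dimD d h))
  (Phi_zero : forall h n, preserves_zero_coordinates (Phi h n))
  (Theta_step : forall h n w,
     Theta h n.+1 w =
     (Theta h n w : 'rV[R]_(dimD d h)) -
     Phi h n (\matrix_(i < n.+1, j < dimD d h) G h i (Theta h i w) w 0 j))
  (L : forall h, 'rV[R]_(dimD d h) -> R)
  (LE : forall h, (0 < h)%N -> forall theta : 'rV[R]_(dimD d h),
     ((L h theta)%:E =
      'E_P[fun w =>
               (`|shallow_net sigma theta (X 0%N 0%N w) - Y 0%N 0%N w| ^+ 2)%R])%E)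
  (cond_exp_Y : exists Z : Omega -> R,
     is_cond_expectation P (Y 0%N 0%N) (X 0%N 0%N) Z /\
     {ae P, forall w, Z w = f (X 0%N 0%N w)})
  (X_law : forall B : set (borel_rV R d), measurable B ->
     B `<=` cube a b d -> P [set w | B (X 0%N 0%N w)] = mu B)
  (Theta0_indep : forall h, (0 < h)%N ->
     mutually_independent P
       (fun (i : 'I_(h * d + h)) (w : Omega) =>
          param (d := d) (h := h) (Theta h 0%N w) i))
  (q : R -> R) (q_ge0 : forall x, 0 <= q x)
  (q_measurable : measurable_fun setT q)
  (eta : R) (eta_gt0 : 0 < eta)
  (q_gt0 : `]- eta, eta[%classic `<=` q @^-1` `]0, +oo[%classic)
  (kappa : R)
  (Theta0_law : forall h, (0 < h)%N -> forall (i : 'I_(h * d + h)) (x : R),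
     P [set w | h%:R `^ kappa * param (d := d) (h := h) (Theta h 0%N w) i < x] =
     (\int[lebesgue_measure]_(y in `]-oo, x[) (q y)%:E)%E)
  (L_min : forall h, (0 < h)%N -> exists vartheta : 'rV[R]_(dimD d h),
     L h vartheta = inf (range (L h)) /\
     ('E_P[fun w => (`|f (X 0%N 0%N w) - Y 0%N 0%N w| ^+ 2)%R]
        < (inf (range (L h)))%:E)%E) :
  exists delta : R, 0 < delta /\
    forall h, (0 < h)%N ->
      (P [set w | limn_einf (fun n => (L h (Theta h n w))%:E)
                  = (inf (range (L h)))%:E]
       <= (delta^-1 * expR (- (delta * h%:R)))%:E)%E.
Proof.
have sigma0 t : t <= 0 -> sigma t = 0.
  by move=> t0; rewrite sigmaE max_r// expr0n eqn0Ngt k_gt0.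
pose X0 : {RV P >-> borel_rV R d} := X 0%N 0%N.
pose Y0 : {RV P >-> R} := Y 0%N 0%N.
have X0_cube w : cube a b d (X0 w) by exact: X_cube.
have riskL h (theta : 'rV[R]_(dimD d h)) : (0 < h)%N ->
    (L h theta)%:E = risk X0 Y0 sigma theta by move=> h_gt0; rewrite LE.
have L_lb h : (0 < h)%N -> has_lbound (range (L h)).
  by move=> h_gt0; exists 0 => _ [theta _ <-]; rewrite -lee_fin riskL// risk_ge0.
(* Without a strict decrease, a minimizer at width [h] could not be improved by another neuron; its
   risk would then be that of [f], which [L_min] excludes. *)
have decrease h : (0 < h)%N -> inf (range (L h.+1)) < inf (range (L h)).
  move=> h_gt0; have [vartheta [Linf f_lt]] := L_min h h_gt0.
  rewrite ltNge; apply/negP => inf_le.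
  have [Z0 [condZ0 Z0f]] := cond_exp_Y.
  move: f_lt; rewrite -Linf riskL//.
  rewrite (shallow_net_eq_regression k_gt0 sigmaE X0_cube f_measurable condZ0 Z0f).
  - by rewrite ltxx.
  - by rewrite -riskL// ltry.
  - move=> theta'; rewrite -!riskL// lee_fin Linf (le_trans inf_le)//.
    by apply: ge_inf; [exact: L_lb|exists theta'].
have q_gt0' x : - eta < x < eta -> 0 < q x.
  by move=> xeta; have := q_gt0 x; rewrite /= !in_itv/= andbT; apply.
have [p [p_gt0 dead_prob]] := dead_neuron_probability d_gt0 a b Theta0_indep
  q_ge0 q_measurable eta_gt0 q_gt0' Theta0_law.
pose event h := [set w | limn_einf (fun n => (L h (Theta h n w))%:E)
                  = (inf (range (L h)))%:E].
have m_event h : (0 < h)%N -> measurable (event h).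
  move=> h_gt0.
  have mL n : measurable_fun setT (fun w => (L h (Theta h n w))%:E).
    under eq_fun do rewrite riskL//.
    apply: (measurableT_comp
      (f := risk X0 Y0 sigma (h := h) : borel_rV R _ -> \bar R)) => //.
    exact: (measurable_risk X0 Y0 sigmaE).
  have mliminf : measurable_fun setT
      (fun w => limn_einf (fun n => (L h (Theta h n w))%:E)).
    under eq_fun do rewrite /limn_einf.
    apply: measurableT_comp => //; apply: measurable_fun_limn_esup => n.
    exact: measurableT_comp.
  rewrite (_ : event h = (fun w => limn_einf (fun n => (L h (Theta h n w))%:E))
    @^-1` [set (inf (range (L h)))%:E])//.
  rewrite -[_ @^-1` _]setTI; apply: mliminf => //; exact: emeasurable_set1.
(* At width 1 the number [1 - p] is itself a probability. *)
have p_le1 : 0 <= 1 - p.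
  have [E [_ _ PE]] := dead_prob 1%N isT.
  by rewrite -lee_fin -(expr1 (1 - p)) -PE measure_ge0.
apply: (@expR_tail_bound _ p (fun h => P (event h))) => //.
  exact: probability_le1 (m_event _ _).
(* Width at least 2, so that the network left after removing a neuron has positive width and
   [decrease] applies to it. *)
move=> h; have [E [mE E_dead PE]] := dead_prob h.+2 isT.
rewrite -PE; apply: le_measure; rewrite ?inE.
- exact: m_event.
- by apply: fin_bigcap_measurable => // i _; exact: measurableC.
move=> w event_w i _ Ew.
have frozen n x : preactivation (Theta h.+2 n w : 'rV[R]_(dimD d h.+2)) i x =
    preactivation (Theta h.+2 0%N w : 'rV[R]_(dimD d h.+2)) i x.
  apply: (dead_neuron_frozen sigma0 (C := cube a b d)
    (xs := fun n m => X m n w) (G := fun n th => G h.+2 n th w)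
    (theta := fun n => Theta h.+2 n w)).
  - by move=> m l; exact: X_cube.
  - by move=> m; exact: G_gradient.
  - by move=> m; exact: (@Phi_zero h.+2 m).
  - by move=> m; exact: Theta_step.
  - by move=> y yC; exact: E_dead.
have L_ge n : inf (range (L h.+1)) <= L h.+2 (Theta h.+2 n w).
  have dead x : cube a b d x ->
      preactivation (Theta h.+2 n w : 'rV[R]_(dimD d h.+2)) i x < 0.
    by move=> xC; rewrite frozen; exact: E_dead.
  have [theta' risk_eq] := risk_remove_neuron Y0 k_gt0 sigmaE X0_cube dead.
  rewrite -lee_fin riskL// risk_eq -riskL// lee_fin.
  by apply: ge_inf; [exact: L_lb|exists theta'].
have := @limn_einf_ge _ (fun n => (L h.+2 (Theta h.+2 n w))%:E)
  (inf (range (L h.+1)))%:E (fun n => L_ge n).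
by rewrite event_w lee_fin leNgt decrease.
Qed.
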